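(* Let $L\in\{A_1,A_2,D_4,E_8\}$, $m:=\dim L$, and $n_L:=\min(N(L)\setminus\{1\})$ where $N(L):=\{\|z\|_2^m:z\in\overline{L}\setminus\{0\}\}$. Then the lattice code in $\mathbb{R}^m/L$ of size $n_L$ is optimal and unique up to isometry (every optimal code of size $n_L$ in $\mathbb{R}^m/L$ is its image under an isometry of $\mathbb{R}^m/L$), and every optimal code of size $n_L-1$ is, up to an isometry of $\mathbb{R}^m/L$, a subset of this lattice code.
   Context: $A_n$ is the set of points of $\mathbb{Z}^{n+1}$ with coordinate sum zero, viewed as a lattice in the hyperplane $\{\sum_ix_i=0\}\cong\mathbb{R}^n$; $D_4$ is the set of points of $\mathbb{Z}^4$ with even coordinate sum; $E_8$ is the set of points of $\mathbb{Z}^8\cup(\mathbb{Z}+\tfrac12)^8$ with even coordinate sum. $\ell(L)$ is the minimal norm of a nonzero lattice vector and $\overline{L}:=\ell(L)^{-1}L$. The torus $\mathbb{R}^m/L$ has metric $d(x,y):=\min\{\|s-t\|_2:s\in x,t\in y\}$; an optimal code of size $n$ is an $n$-element subset maximizing the minimum pairwise distance. $\operatorname{CO}(m):=\{cQ:c>0,Q\in\operatorname{O}(m)\}$; a lattice code is a set $(TL)/L$ with $T\in\operatorname{CO}(m)$ and $L\subseteq TL$, of size $|TL:L|$. (Lattice codes of size $n_L$ exist.) *)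

(* Defs.v *)
From HB Require Import structures.
From mathcomp Require Import all_boot all_order all_algebra.
From mathcomp Require Import classical_sets reals.
Unset Printing Implicit Defensive.
Import Order.TTheory GRing.Theory Num.Theory.
Local Open Scope ring_scope.
Local Open Scope classical_set_scope.

Inductive lat := A1 | A2 | D4 | E8.

(* Dimension of the ambient coordinate space R^k in which L is written
   (A_n lives in the hyperplane sum = 0 of R^(n+1)). *)
Definition amb (L : lat) : nat :=
  match L with A1 => 2 | A2 => 3 | D4 => 4 | E8 => 8 end.

Definition dimL (L : lat) : nat :=
  match L with A1 => 1 | A2 => 2 | D4 => 4 | E8 => 8 end.

Section Lattices.
Variable R : realType.

Definition vec (L : lat) := 'rV[R]_(amb L).

Definition csum {k} (v : 'rV[R]_k) : R := \sum_i v 0 i.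

Definition all_int {k} (v : 'rV[R]_k) : Prop := forall i, v 0 i \is a Num.int.
Definition all_halfint {k} (v : 'rV[R]_k) : Prop :=
  forall i, v 0 i - 2^-1 \is a Num.int.

(* The ambient Euclidean space R^m of the torus R^m / L:
   the hyperplane {sum x_i = 0} for A_n, the whole R^k otherwise. *)
Definition amb_space (L : lat) : set (vec L) :=
  match L with
  | A1 | A2 => [set v | csum v = 0]
  | D4 | E8 => setT
  end.

Definition lattice (L : lat) : set (vec L) :=
  match L with
  | A1 | A2 => [set v | all_int v /\ csum v = 0]
  | D4 => [set v | all_int v /\ (csum v / 2) \is a Num.int]
  | E8 => [set v | (all_int v \/ all_halfint v) /\ (csum v / 2) \is a Num.int]
  end.

Definition norm2 {k} (v : 'rV[R]_k) : R := Num.sqrt (\sum_i v 0 i ^+ 2).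

Definition ell (L : lat) : R :=
  inf [set norm2 v | v in [set v : vec L | lattice L v /\ v != 0]].

Definition Lbar (L : lat) : set (vec L) :=
  [set (ell L)^-1 *: v | v in lattice L].

Definition NL (L : lat) : set R :=
  [set norm2 z ^+ dimL L | z in [set z : vec L | Lbar L z /\ z != 0]].

Definition is_nL (L : lat) (n : nat) : Prop :=
  NL L (n%:R : R) /\ (n%:R : R) != 1 /\
  (forall x, NL L x -> x != 1 -> (n%:R : R) <= x).

Definition tdist (L : lat) (x y : vec L) : R :=
  inf [set norm2 (x - y - l) | l in lattice L].

(* equality of points of the torus R^m / L, on representatives *)
Definition teq (L : lat) (x y : vec L) : Prop := lattice L (x - y).

(* A code of size n in R^m/L, given by representatives of its n distinct
   points. *)
Definition is_code (L : lat) (n : nat) (c : 'I_n -> vec L) : Prop :=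
  (forall i, amb_space L (c i)) /\
  (forall i j, i != j -> ~ teq L (c i) (c j)).

Definition mindist (L : lat) (n : nat) (c : 'I_n -> vec L) : R :=
  inf [set tdist L (c ij.1) (c ij.2) | ij in [set ij : 'I_n * 'I_n | ij.1 != ij.2]].

Definition optimal_code (L : lat) (n : nat) (c : 'I_n -> vec L) : Prop :=
  is_code L n c /\ forall c' : 'I_n -> vec L, is_code L n c' -> mindist L n c' <= mindist L n c.

(* An isometry of the torus R^m/L, given by a lift g on representatives:
   g maps R^m to R^m, is well defined on classes mod L, preserves the torus
   metric and is surjective on the torus (injectivity follows). *)
Definition torus_isometry (L : lat) (g : vec L -> vec L) : Prop :=
  (forall x, amb_space L x -> amb_space L (g x)) /\
  (forall x y, amb_space L x -> amb_space L y -> teq L x y -> teq L (g x) (g y)) /\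
  (forall x y, amb_space L x -> amb_space L y -> tdist L (g x) (g y) = tdist L x y) /\
  (forall y, amb_space L y -> exists2 x, amb_space L x & teq L (g x) y).

(* T in CO(m): a linear map of R^m (acting on row vectors, restricted to the
   space R^m of L) of the form c Q with c > 0 and Q orthogonal, i.e. a
   linear map of R^m into itself scaling all norms by c > 0. *)
Definition in_CO (L : lat) (T : 'M[R]_(amb L)) : Prop :=
  exists2 s : R, 0 < s &
    forall v, amb_space L v -> amb_space L (v *m T) /\ norm2 (v *m T) = s * norm2 v.

Definition image_lattice (L : lat) (T : 'M[R]_(amb L)) : set (vec L) :=
  [set v *m T | v in lattice L].

(* c enumerates (by representatives) the lattice code (T L)/L, where
   T in CO(m), L subset of T L; its size |TL : L| is then n. *)
Definition is_lattice_code (L : lat) (n : nat) (c : 'I_n -> vec L) : Prop :=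
  exists T : 'M[R]_(amb L),
    [/\ in_CO L T,
        lattice L `<=` image_lattice L T,
        (forall i, image_lattice L T (c i)),
        (forall i j, i != j -> ~ teq L (c i) (c j)) &
        (forall x, image_lattice L T x -> exists i, teq L x (c i))].

End Lattices.

Arguments vec {R} L.
Arguments amb_space {R} L _.
Arguments lattice {R} L _.
Arguments ell {R} L.
Arguments Lbar {R} L _.
Arguments NL {R} L _.
Arguments tdist {R} L x y.
Arguments teq {R} L x y.
Arguments is_code {R} L n c.
Arguments mindist {R} L n c.
Arguments optimal_code {R} L n c.
Arguments torus_isometry {R} L g.
Arguments in_CO {R} L T.
Arguments image_lattice {R} L T _.
Arguments is_lattice_code {R} L n c.
Arguments is_nL {R} L n.

(* Main.v *)
Require Import Defs.
From mathcomp Require Import all_boot all_order all_algebra.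
From mathcomp Require Import classical_sets reals.
From mathcomp Require Import boolp ring lra zify.
Import Order.TTheory GRing.Theory Num.Theory.
Local Open Scope ring_scope.

(* No two points of the torus are farther apart than the covering radius rho of L
   (rho^2 = 1/2, 2/3, 1, 1), and the lattice code of size n_L attains rho for every pair of
   its points, so the optimal codes of size n_L and n_L - 1 are exactly those with all
   pairwise distances equal to rho.  After a translation their points are lattice points or
   deep holes of L.  For A1, A2 and D4 there are only n_L such classes modulo L, so they all
   belong to the lattice code.  For E8 these points lie in L/2, and in (L/2)/L with its
   quadratic form the lattice code M/L is a maximal totally singular subspace, while an
   optimal code is a totally singular set.  If a point u' of the code is not in M, then some
   u in M is not orthogonal to u' modulo 2, and the reflection in the root of L congruent to
   2(u - u') modulo 2L moves u' to u and fixes the points of the code already in M;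
   repeating this moves the whole code into M. *)

(** All four lattices are even with minimal norm 2. If the next norm is [2 q] ([q] = 4, 3, 2, 2),
    then rho^2 = 2/q and n_L = q^(m/2). A similarity of ratio [s] turns the minimal norm into
    [2 s^2], so TL/L attains rho exactly when [2 s^2 = rho2 L]. The index |TL : L| would give [s]
    through volumes; here a pigeonhole argument does: among n_L + 1 lattice vectors that are close
    together, two get the same image modulo L, which is impossible if [s] is too small. The reverse
    inequality is the covering bound applied to a point of TL outside L. The covering radii are
    found without Voronoi cells. For A2, D4 and E8, [x] is compared with a few nearby lattice
    points, and a nonnegative combination of the resulting inequalities makes a sum of nonnegative
    terms at most 0; so every term vanishes, which gives the bound and the deep holes together. For
    E8 counting fails: there are 135 classes of deep holes, and a code uses only 15 of them besides
    0. What replaces it is that M is its own dual for the form [2 x.y], because E8 is self-dual and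
    [2 s^2 = 1]. *)

Section Integers.
Context {R : realType}.
Implicit Types x y : R.

Lemma intr_parity x : x \is a Num.int ->
  (x / 2 \is a Num.int) \/ ((x - 1) / 2 \is a Num.int).
Proof.
move=> /intrP[z ->].
have [q [->|->]] : exists q : int, z = 2 * q \/ z = 2 * q + 1.
- by exists (z %/ 2)%Z; lia.
- left; apply/intrP; exists q; rewrite intrM; by field.
- right; apply/intrP; exists q; rewrite intrD intrM; by field.
Qed.

Lemma intr_tri x : x \is a Num.int -> (x ^+ 2 - x) / 2 \is a Num.int.
Proof.
move=> hx; have [h|h] := intr_parity x hx.
- rewrite (_ : _ / _ = (x / 2) * x - x / 2); last by field.
  by apply: rpredB => //; apply: rpredM.
- rewrite (_ : _ / _ = (x - 1) / 2 * x); last by field.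
  by apply: rpredM.
Qed.

Lemma intr_ge x (m : int) : x \is a Num.int -> m%:~R < x -> (m + 1)%:~R <= x.
Proof. by move=> /intrP[z ->]; rewrite ltr_int ler_int; lia. Qed.

(** The side [s] is kept apart from the distance [d]: estimates involve [d] only, while [n + s] is
    the integer to use when [n] has the wrong parity. *)
Lemma nearest_int x : exists n s d : R,
  [/\ n \is a Num.int, s = 1 \/ s = -1, 0 <= d <= 1/2 & x = n + s * d].
Proof.
have h1 : (Num.floor (x + 1/2))%:~R <= x + 1/2 by exact: floor_le.
have h2 : x + 1/2 < (Num.floor (x + 1/2) + 1)%:~R by exact: floorD1_gt.
rewrite intrD in h2.
set n : R := (Num.floor _)%:~R in h1 h2.
have hn : n \is a Num.int by apply: intr_int.
have [h|h] := leP n x.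
- exists n, 1, (x - n); split=> //; [by left| by apply/andP; split; lra| by ring].
- exists n, (-1), (n - x); split=> //; [by right| by apply/andP; split; lra| by ring].
Qed.

Lemma nearest_int_fun (k : nat) (x : 'I_k -> R) : exists n s d : 'I_k -> R,
  [/\ forall i, n i \is a Num.int, forall i, s i = 1 \/ s i = -1,
      forall i, 0 <= d i <= 1/2 & forall i, x i = n i + s i * d i].
Proof.
have /choice[f hf] : forall i, exists p : R * R * R,
  [/\ p.1.1 \is a Num.int, p.1.2 = 1 \/ p.1.2 = -1, 0 <= p.2 <= 1/2
    & x i = p.1.1 + p.1.2 * p.2].
  by move=> i; have [n [s [d h]]] := nearest_int (x i); exists (n, s, d).
by exists (fun i => (f i).1.1), (fun i => (f i).1.2), (fun i => (f i).2);
  split=> i; have [] := hf i.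
Qed.

End Integers.

(** * Scalar product and coordinate sum *)

Section Dot.
Context {R : realType} {k : nat}.
Implicit Types u v w : 'rV[R]_k.

Definition dot u v : R := \sum_i u 0 i * v 0 i.

Lemma dotC u v : dot u v = dot v u.
Proof. by apply: eq_bigr => i _; rewrite mulrC. Qed.

Lemma dotDl u v w : dot (u + v) w = dot u w + dot v w.
Proof. by rewrite -big_split; apply: eq_bigr => i _ /=; rewrite !mxE mulrDl. Qed.

Lemma dotNl u v : dot (- u) v = - dot u v.
Proof. by rewrite -sumrN; apply: eq_bigr => i _ /=; rewrite !mxE mulNr. Qed.

Lemma dotZl a u v : dot (a *: u) v = a * dot u v.
Proof. by rewrite mulr_sumr; apply: eq_bigr => i _ /=; rewrite !mxE mulrA. Qed.

Lemma dotDr u v w : dot w (u + v) = dot w u + dot w v.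
Proof. by rewrite ![dot w _]dotC dotDl. Qed.

Lemma dotNr u v : dot v (- u) = - dot v u.
Proof. by rewrite ![dot v _]dotC dotNl. Qed.

Lemma dotZr a u v : dot v (a *: u) = a * dot v u.
Proof. by rewrite ![dot v _]dotC dotZl. Qed.

Definition dotE := (dotDl, dotDr, dotNl, dotNr, dotZl, dotZr).

Lemma dot0 : dot 0 0 = 0.
Proof. by rewrite /dot big1 // => i _; rewrite mxE mul0r. Qed.

Lemma dot_ge0 u : 0 <= dot u u.
Proof. by apply: sumr_ge0 => i _; rewrite -expr2 sqr_ge0. Qed.

Lemma dot_eq0 u : dot u u = 0 -> u = 0.
Proof.
move=> /eqP; rewrite psumr_eq0; last by move=> i _; rewrite -expr2 sqr_ge0.
move=> /allP h; apply/rowP => i; rewrite mxE.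
by have := h i (mem_index_enum _); rewrite /= mulf_eq0 orbb => /eqP.
Qed.

Lemma norm2E u : norm2 R u = Num.sqrt (dot u u).
Proof. by congr Num.sqrt; apply: eq_bigr => i _; rewrite expr2. Qed.

Lemma norm2_ge0 u : 0 <= norm2 R u.
Proof. exact: sqrtr_ge0. Qed.

Lemma norm2_sqr u : norm2 R u ^+ 2 = dot u u.
Proof. by rewrite norm2E sqr_sqrtr ?dot_ge0. Qed.

Lemma norm2_ge u (r : R) : 0 <= r -> (r <= norm2 R u) = (r ^+ 2 <= dot u u).
Proof. by move=> r0; rewrite -norm2_sqr ler_sqr ?nnegrE ?norm2_ge0. Qed.

Lemma dot_mulmx m (u : 'rV[R]_m) v (T : 'M[R]_(m, k)) :
  dot (u *m T) v = \sum_i u 0 i * dot (row i T) v.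
Proof.
rewrite /dot.
under eq_bigr do rewrite mxE mulr_suml.
rewrite exchange_big; apply: eq_bigr => i _; rewrite mulr_sumr.
by apply: eq_bigr => j _; rewrite !mxE mulrA.
Qed.

Lemma csumD u v : csum R (u + v) = csum R u + csum R v.
Proof. by rewrite -big_split; apply: eq_bigr => i _; rewrite !mxE. Qed.

Lemma csumB u v : csum R (u - v) = csum R u - csum R v.
Proof. by rewrite -sumrB; apply: eq_bigr => i _; rewrite !mxE. Qed.

Lemma csum0 : csum R (0 : 'rV[R]_k) = 0.
Proof. by rewrite /csum big1 // => i _; rewrite mxE. Qed.

Lemma csumZ a u : csum R (a *: u) = a * csum R u.
Proof. by rewrite mulr_sumr; apply: eq_bigr => i _; rewrite !mxE. Qed.

(** An integer and its square have the same parity, so the norm and the coordinate sum agree modulo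
    2. *)
Lemma all_int_even u : all_int R u -> csum R u / 2 \is a Num.int ->
  dot u u / 2 \is a Num.int.
Proof.
move=> iu hu.
rewrite (_ : _ / _ = \sum_i (u 0 i ^+ 2 - u 0 i) / 2 + csum R u / 2).
  by apply: rpredD => //; apply: rpred_sum => i _; apply: intr_tri.
rewrite -mulr_suml -mulrDl sumrB subrK; congr (_ / _).
Qed.

End Dot.
Arguments dot {R k} u v.

(** * The four even lattices and distances modulo L *)

Section Lattice.
Context {R : realType}.

Lemma all_intB k (u v : 'rV[R]_k) : all_int R u -> all_int R v -> all_int R (u - v).
Proof. by move=> hu hv i; rewrite !mxE; apply: rpredB. Qed.

Lemma lattice0 (L : lat) : lattice L (0 : @vec R L).
Proof.
have h k : all_int R (0 : 'rV[R]_k) by move=> i; rewrite mxE rpred0.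
case: L => /=; split; rewrite ?csum0 ?mul0r ?rpred0 //.
by left.
Qed.

Lemma latticeB (L : lat) (u v : @vec R L) :
  lattice L u -> lattice L v -> lattice L (u - v).
Proof.
case: L u v => /= u v [hu eu] [hv ev]; split; rewrite ?csumB ?eu ?ev ?subrr ?mulrBl //;
  try exact: all_intB; try by apply: rpredB.
case: hu hv => hu [] hv; [by left; apply: all_intB|right|right|left] => i.
- rewrite !mxE (_ : _ - _ = u 0 i - (v 0 i - 2^-1) - 1); last by field.
  by rewrite rpredB ?rpred1 //; apply: rpredB.
- by rewrite !mxE addrAC; apply: rpredB.
- rewrite !mxE (_ : _ - _ = (u 0 i - 2^-1) - (v 0 i - 2^-1)); last by ring.
  exact: rpredB.
Qed.

Lemma latticeN (L : lat) (u : @vec R L) : lattice L u -> lattice L (- u).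
Proof. by move=> hu; rewrite -sub0r; apply: latticeB (lattice0 L) hu. Qed.

Lemma latticeD (L : lat) (u v : @vec R L) :
  lattice L u -> lattice L v -> lattice L (u + v).
Proof. by move=> hu hv; rewrite -[v]opprK; apply/latticeB/latticeN. Qed.

Lemma latticeZ (L : lat) (u : @vec R L) (a : R) :
  a \is a Num.int -> lattice L u -> lattice L (a *: u).
Proof.
move=> /intrP[z ->] hu.
have hn (m : nat) : lattice L (m%:~R *: u).
  elim: m => [|m ih]; first by rewrite scale0r; apply: lattice0.
  rewrite (_ : m.+1%:~R = 1 + m%:~R); last by rewrite -pmulrn -pmulrn mulrS.
  by rewrite scalerDl scale1r; apply: latticeD.
case: z => m; first exact: hn.
by rewrite NegzE mulrNz scaleNr; apply/latticeN/hn.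
Qed.

Lemma lattice_even (L : lat) (u : @vec R L) : lattice L u -> dot u u / 2 \is a Num.int.
Proof.
case: L u => /= u [hu eu].
1,2: by apply: all_int_even => //; rewrite eu mul0r rpred0.
  exact: all_int_even.
have {hu} [hu|hu] := hu; first exact: all_int_even.
(* With [a_i = u_i - 1/2] one has [u_i^2 = (a_i^2 - a_i) + 2 u_i - 3/4]; the eight constants add up
   to 6, halved to 3. *)
pose a : 'rV[R]_8 := \row_i (u 0 i - 2^-1).
have -> : dot u u / 2 = \sum_i (a 0 i ^+ 2 - a 0 i) / 2 + csum R u - 3.
  rewrite -mulr_suml sumrB /dot /csum !big_ord_recl !big_ord0 /= !mxE; by field.
apply: rpredB; last exact: rpred_nat.
apply: rpredD.
  by apply: rpred_sum => i _; apply: intr_tri; rewrite mxE; apply: hu.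
rewrite (_ : csum R u = csum R u / 2 * 2); last by rewrite divfK // pnatr_eq0.
by apply: rpredM => //; apply: rpred_nat.
Qed.

Lemma lattice_dot_int (L : lat) (u v : @vec R L) :
  lattice L u -> lattice L v -> dot u v \is a Num.int.
Proof.
move=> hu hv.
have -> : dot u v = dot (u + v) (u + v) / 2 - dot u u / 2 - dot v v / 2.
  by rewrite !dotE (dotC v u); field.
by rewrite !rpredB //; apply: lattice_even => //; apply: latticeD.
Qed.

Lemma lattice_min (L : lat) (u : @vec R L) : lattice L u -> u != 0 -> 2 <= dot u u.
Proof.
move=> hu u0.
have : 0 < dot u u.
  rewrite lt_def dot_ge0 andbT; apply: contra u0 => /eqP h; apply/eqP; exact: dot_eq0.
move=> h; have := @intr_ge R _ 0 (lattice_even L u hu).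
by rewrite add0r => /(_ ltac:(lra)); lra.
Qed.

Lemma lattice_amb (L : lat) (u : @vec R L) : lattice L u -> amb_space L u.
Proof. by case: L u => //= u []. Qed.

Lemma ambB (L : lat) (u v : @vec R L) :
  amb_space L u -> amb_space L v -> amb_space L (u - v).
Proof. by case: L u v => //= u v hu hv; rewrite csumB hu hv subrr. Qed.

Lemma ambD (L : lat) (u v : @vec R L) :
  amb_space L u -> amb_space L v -> amb_space L (u + v).
Proof.
move=> hu hv; rewrite -[v]opprK; apply: ambB => //; rewrite -sub0r.
by apply: ambB => //; apply/lattice_amb/lattice0.
Qed.

Lemma teq_refl (L : lat) (u : @vec R L) : teq L u u.
Proof. by rewrite /teq subrr; apply: lattice0. Qed.

Lemma teq_sym (L : lat) (u v : @vec R L) : teq L u v -> teq L v u.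
Proof. by rewrite /teq => h; rewrite -opprB; apply: latticeN. Qed.

Lemma teq_trans (L : lat) (v u w : @vec R L) : teq L u v -> teq L v w -> teq L u w.
Proof. by rewrite /teq => h g; rewrite -(subrK v u) -addrA; apply: latticeD. Qed.

(* [r2] bounds the squared distance. *)
Definition far (L : lat) (r2 : R) (x : @vec R L) :=
  forall l, lattice L l -> r2 <= dot (x - l) (x - l).

Lemma far_teq (L : lat) r2 (x y : @vec R L) : teq L x y -> far L r2 x -> far L r2 y.
Proof.
move=> h f l hl; have := f (x - y + l) (latticeD _ _ _ h hl).
by rewrite (_ : x - (x - y + l) = y - l) //; apply/rowP => i; rewrite !mxE; ring.
Qed.

(** This trades the infimum for a bound on all lattice vectors, so no minimum has to be shown to be
    attained. *)
Lemma tdist_ge (L : lat) (x y : @vec R L) r :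
  0 <= r -> r <= tdist L x y <-> far L (r ^+ 2) (x - y).
Proof.
move=> r0; split=> [h l hl|h].
  rewrite -norm2_ge //; apply: (le_trans h); apply: ge_inf; last by exists l.
  by exists 0 => _ [z _ <-]; apply: norm2_ge0.
apply: lb_le_inf; first by exists (norm2 R (x - y - 0)); exists 0 => //; apply: lattice0.
by move=> _ [l hl <-]; rewrite norm2_ge //; apply: h.
Qed.

Lemma tdist_ge0 (L : lat) (x y : @vec R L) : 0 <= tdist L x y.
Proof. by apply/tdist_ge => // l _; rewrite expr0n /= dot_ge0. Qed.

End Lattice.

(** * Inequalities satisfied by points far from E8 *)

Section Holes.
Context {R : realType}.

Definition mkrow k (s : seq R) : 'rV[R]_k := \row_(i < k) s`_i.

(** The rounding rule for vectors of even sum: [m] is the rounding of [x]; if its sum is odd, one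
    coordinate moves on to [m i + s i], which replaces [e i ^+ 2] by [(1 - e i) ^+ 2]. Both integral
    and half-integral roundings fit. *)
Lemma parity_flip k (x : 'rV[R]_k) (m s e : 'I_k -> R) (r : R) :
  \sum_i m i \is a Num.int -> (forall i, s i = 1 \/ s i = -1) ->
  (forall i, x 0 i = m i + s i * e i) ->
  (forall l : 'rV[R]_k, (forall i, l 0 i - m i \is a Num.int) ->
     csum R l / 2 \is a Num.int -> r <= dot (x - l) (x - l)) ->
  ((\sum_i m i) / 2 \is a Num.int -> r <= \sum_i e i ^+ 2) /\
  ((\sum_i m i) / 2 \isn't a Num.int -> forall i, r <= \sum_i e i ^+ 2 + 1 - 2 * e i).
Proof.
move=> mint s1 xE far.
have ss i : s i ^+ 2 = 1 by case: (s1 i) => ->; rewrite ?sqrrN expr1n.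
split=> [ev|od i].
  have := far (\row_i m i) _ _; rewrite /csum.
  under [in X in _ -> X -> _]eq_bigr do rewrite mxE.
  move=> /(_ _ ev) h; apply: (le_trans (h _)).
    by move=> i; rewrite mxE subrr rpred0.
  rewrite le_eqVlt; apply/orP; left; apply/eqP/eq_bigr => i _.
  by rewrite !mxE xE addrC addKr -expr2 exprMn ss mul1r.
have od' : (\sum_i m i - 1) / 2 \is a Num.int.
  by case: (intr_parity _ mint) => // h; rewrite h in od.
pose l : 'rV[R]_k := \row_j (m j + if j == i then s j else 0).
have h : r <= dot (x - l) (x - l).
  apply: far => [j|].
    rewrite mxE addrC addKr; case: eqP => _; last exact: rpred0.
    by case: (s1 j) => ->; rewrite ?rpredN rpred1.
  rewrite /csum; under eq_bigr do rewrite mxE.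
  rewrite big_split /= -big_mkcond big_pred1_eq.
  case: (s1 i) => -> //.
  rewrite (_ : (_ + 1) / 2 = (\sum_i m i - 1) / 2 + 1); last by field.
  by apply: rpredD => //; apply: rpred1.
apply: (le_trans h); rewrite /dot (bigD1 i) //= [in leRHS](bigD1 i) //=.
rewrite (eq_bigr (fun j => e j ^+ 2)); last first.
  move=> j /negPf ji; rewrite !mxE ji xE addr0 addrC addKr -expr2 exprMn ss mul1r //.
rewrite !mxE eqxx xE le_eqVlt; apply/orP; left; apply/eqP.
have -> : (m i + s i * e i - (m i + s i)) * (m i + s i * e i - (m i + s i))
  = s i ^+ 2 * (e i - 1) ^+ 2 by ring.
by rewrite ss; ring.
Qed.

(** Only the first inequality at the largest value [M] and the second at the smallest value [mu] are
    needed. Weighted by [1 - mu - M] and [mu + M], they give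
    [K + t + (M - mu) (1 - 2 (M - mu)) <= 0], where [K] is the sum of [(M - d j) (d j - mu)]. All
    three terms are nonnegative, so every [d j] is [M] or [mu], and [M - mu] is 0 or 1/2. *)
Lemma E8_hole_ineq (d : 'I_8 -> R) (t : R) :
  0 <= t -> (forall i, 0 <= d i <= 1/2) ->
  (forall i, t + 2 * d i <= \sum_j d j ^+ 2) ->
  (forall i, t + (1 - 2 * d i) <= \sum_j (1/2 - d j) ^+ 2) ->
  t = 0 /\ ((forall i, d i = 1/4) \/
     ((forall i, d i = 0 \/ d i = 1/2) /\ \sum_j d j \is a Num.int)).
Proof.
move=> t0 d01 hA hB.
have [iM hM] : exists i, forall j, d j <= d i.
  by case: (arg_maxP d (erefl : xpredT (@ord0 7))) => i _ h; exists i => j; apply: h.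
have [im hm] : exists i, forall j, d i <= d j.
  by case: (arg_minP d (erefl : xpredT (@ord0 7))) => i _ h; exists i => j; apply: h.
set M := d iM in hM; set mu := d im in hm.
have /andP[M0 M1] : 0 <= M <= 1/2 by apply: d01.
have /andP[mu0 mu1] : 0 <= mu <= 1/2 by apply: d01.
have muM : mu <= M by apply: hM.
have := hA iM; have := hB im; rewrite -/M -/mu.
set Q := \sum_j d j ^+ 2; set S := \sum_j d j.
have -> : \sum_j (1/2 - d j) ^+ 2 = Q - S + 2.
  by rewrite /Q /S !big_ord_recl !big_ord0; field.
move=> b a.
pose K := \sum_j (M - d j) * (d j - mu).
have KE : K = (M + mu) * S - Q - 8 * (M * mu).
  by rewrite /K /Q /S !big_ord_recl !big_ord0; ring.
have Kj j : 0 <= (M - d j) * (d j - mu) by rewrite mulr_ge0 // subr_ge0.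
have K0 : 0 <= K by apply: sumr_ge0.
have D0 : 0 <= (M - mu) * (1 - 2 * (M - mu)) by rewrite mulr_ge0 //; lra.
have h1 : 0 <= (1 - mu - M) * (Q - 2 * M - t) by rewrite mulr_ge0 //; lra.
have h2 : 0 <= (mu + M) * (Q - S + 1 + 2 * mu - t) by rewrite mulr_ge0 //; lra.
have hs : K + t + (M - mu) * (1 - 2 * (M - mu)) <= 0.
  have : K + t + (M - mu) * (1 - 2 * (M - mu)) =
     - ((1 - mu - M) * (Q - 2 * M - t) + (mu + M) * (Q - S + 1 + 2 * mu - t)).
    by rewrite KE; ring.
  by move->; lra.
have K00 : K = 0 by lra.
have t00 : t = 0 by lra.
have /eqP D00 : (M - mu) * (1 - 2 * (M - mu)) = 0 by lra.
split=> //.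
have dj j : d j = M \/ d j = mu.
  have /eqP : (M - d j) * (d j - mu) = 0.
    have /eqP := K00; rewrite psumr_eq0 // => /allP /(_ j (mem_index_enum _)) /eqP.
    exact.
  rewrite mulf_eq0 => /orP[] /eqP; [left|right]; lra.
move: D00; rewrite mulf_eq0 => /orP[] /eqP D00.
  have dM j : d j = M by case: (dj j) => ->; lra.
  have Q8 : Q = 8 * M ^+ 2.
    by rewrite /Q; under eq_bigr do rewrite dM; rewrite !big_ord_recl big_ord0; ring.
  have S8 : S = 8 * M.
    by rewrite /S; under eq_bigr do rewrite dM; rewrite !big_ord_recl big_ord0; ring.
  have e1 : 0 <= M * (4 * M - 1) by move: a; rewrite Q8; lra.
  have e2 : 0 <= (1 - 2 * M) * (1 - 4 * M) by move: b; rewrite Q8 S8; lra.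
  have [Mz|Mz] := eqVneq M 0.
    right; split=> [i|]; first by left; rewrite dM.
    by rewrite S8 Mz mulr0 rpred0.
  have [Mh|Mh] := eqVneq M (1/2).
    right; split=> [i|]; first by right; rewrite dM.
    by rewrite S8 Mh (_ : _ * _ = 4%:R); [apply: rpred_nat|field].
  left=> i; rewrite dM.
  have Mp : 0 < M by rewrite lt_def Mz.
  have Ml : 0 < 1 - 2 * M by move: Mh M1; rewrite le_eqVlt => /negPf-> /=; lra.
  move: e1 e2; rewrite pmulr_rge0 // pmulr_rge0 //; lra.
have Mh : M = 1/2 by lra.
have muz : mu = 0 by lra.
right; split=> [i|]; first by case: (dj i) => ->; [right|left].
move: KE; rewrite K00 Mh muz => KE.
(* [K = 0] reads [Q = S/2], and the two inequalities become [Q >= 1] and [S - Q <= 1]: four of the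
   [d j] equal 1/2. *)
rewrite (_ : S = 2%:R); first exact: rpred_nat.
by lra.
Qed.

End Holes.

(** * Deep holes of E8 and D4 *)

Section HoleClasses.
Context {R : realType}.

(** E8 has an integral and a half-integral part, both subject to an even sum. Rounding [x] to each
    part leaves the errors [d i] and [1/2 - d i], hence the two families of [E8_hole_ineq]. *)
Lemma far_E8 (x : @vec R E8) (t : R) : 0 <= t -> far E8 (1 + t) x ->
  t = 0 /\ lattice E8 (2 *: x).
Proof.
move=> t0 f; have [n [s [d [nint s1 d01 xE]]]] := nearest_int_fun 8 (fun i => x 0 i).
have nsum : \sum_i n i \is a Num.int by apply: rpred_sum.
have [evA odA] : ((\sum_i n i) / 2 \is a Num.int -> 1 + t <= \sum_i d i ^+ 2) /\
   ((\sum_i n i) / 2 \isn't a Num.int -> forall i, 1 + t <= \sum_i d i ^+ 2 + 1 - 2 * d i).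
  apply: (@parity_flip R 8 x n s d) => // l hl el; apply: f; split=> //; left=> i.
  by rewrite -(subrK (n i) (l 0 i)); apply: rpredD.
pose m i := n i + s i / 2.
have mhalf i : m i - 2^-1 \is a Num.int.
  rewrite /m; case: (s1 i) => ->; first by rewrite mul1r addrK.
  rewrite mulN1r (_ : _ - _ = n i - 1); last by field.
  by rewrite rpredB ?rpred1.
have msum : \sum_i m i \is a Num.int.
  rewrite (_ : \sum_i m i = \sum_i (m i - 2^-1) + 4%:R).
    by apply: rpredD; [apply: rpred_sum|apply: rpred_nat].
  by rewrite !big_ord_recl !big_ord0; field.
have [evB odB] : ((\sum_i m i) / 2 \is a Num.int -> 1 + t <= \sum_i (1/2 - d i) ^+ 2) /\
   ((\sum_i m i) / 2 \isn't a Num.int ->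
     forall i, 1 + t <= \sum_i (1/2 - d i) ^+ 2 + 1 - 2 * (1/2 - d i)).
  apply: (@parity_flip R 8 x m (fun i => - s i)) => //.
  - by move=> i; case: (s1 i) => ->; rewrite ?opprK; [right|left].
  - by move=> i; rewrite xE /m; field.
  move=> l hl el; apply: f; split=> //; right=> i.
  by rewrite -(subrK (m i) (l 0 i)) -addrA; apply: rpredD.
have [i|i|t00 dc] := E8_hole_ineq d t t0 d01.
- have /andP[d0 d1] := d01 i.
  have [/evA h|/odA /(_ i) h] := boolP ((\sum_i n i) / 2 \is a Num.int); lra.
- have /andP[d0 d1] := d01 i.
  have [/evB h|/odB /(_ i) h] := boolP ((\sum_i m i) / 2 \is a Num.int); lra.
split=> //.
have csE : csum R (2 *: x) / 2 = csum R x by rewrite csumZ mulrAC divff ?mul1r ?pnatr_eq0.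
rewrite /= csE.
case: dc => [d4|[dh dS]].
  split.
    right=> i; rewrite mxE xE d4; case: (s1 i) => ->.
      rewrite (_ : _ - _ = 2%:R * n i); last by field.
      by apply: rpredM => //; apply: rpred_nat.
    rewrite (_ : _ - _ = 2%:R * n i - 1); last by field.
    by apply: rpredB; [apply: rpredM => //; apply: rpred_nat|apply: rpred1].
  (* When all [d i] are 1/4, a rounding of even sum would lie at squared distance 1/2 < 1. So both
     sums are odd, and [x = (n + m)/2] has an integral sum. *)
  have nodd : (\sum_i n i) / 2 \isn't a Num.int.
    apply/negP => /evA; under eq_bigr do rewrite d4.
    by rewrite !big_ord_recl !big_ord0; lra.
  have modd : (\sum_i m i) / 2 \isn't a Num.int.
    apply/negP => /evB; under eq_bigr do rewrite d4.
    by rewrite !big_ord_recl !big_ord0; lra.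
  have [h|h1] := intr_parity _ nsum; first by rewrite h in nodd.
  have [h|h2] := intr_parity _ msum; first by rewrite h in modd.
  rewrite (_ : csum R x = (\sum_i n i - 1) / 2 + ((\sum_i m i) - 1) / 2 + 1).
    by apply: rpredD; [apply: rpredD|apply: rpred1].
  rewrite /csum; under eq_bigr do rewrite xE d4.
  by rewrite /m !big_split /= -!mulr_suml; field.
have d2 i : 2 * d i \is a Num.int.
  by case: (dh i) => ->; rewrite ?mulr0 ?rpred0 // mul1r divff ?rpred1 // pnatr_eq0.
split.
  left=> i; rewrite mxE xE; case: (s1 i) => ->; rewrite ?mul1r ?mulN1r ?mulrDr ?mulrN.
    by apply: rpredD; [apply: rpredM => //; apply: rpred_nat|].
  by apply: rpredB; [apply: rpredM => //; apply: rpred_nat|].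
rewrite (_ : csum R x = \sum_i (x 0 i - d i) + \sum_i d i); last first.
  by rewrite -big_split; apply: eq_bigr => i _ /=; rewrite subrK.
apply: rpredD => //; apply: rpred_sum => i _; rewrite xE.
case: (s1 i) => ->; first by rewrite mul1r addrK.
rewrite (_ : _ - _ = n i - 2 * d i); last by ring.
exact: rpredB.
Qed.

(** Weighting [t + 2 d i <= Q] by [d i] and summing gives [t S <= Q (S - 2)], while [d i <= 1/2]
    forces [S <= 2]. So [Q = 0] (integral point) or [S = 2] (every [d i] is 1/2). *)
Lemma far_D4 (x : @vec R D4) (t : R) : 0 <= t -> far D4 (1 + t) x ->
  t = 0 /\ (all_int R x \/ all_halfint R x).
Proof.
move=> t0 f; have [n [s [d [nint s1 d01 xE]]]] := nearest_int_fun 4 (fun i => x 0 i).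
have nsum : \sum_i n i \is a Num.int by apply: rpred_sum.
have [ev od] : ((\sum_i n i) / 2 \is a Num.int -> 1 + t <= \sum_i d i ^+ 2) /\
   ((\sum_i n i) / 2 \isn't a Num.int -> forall i, 1 + t <= \sum_i d i ^+ 2 + 1 - 2 * d i).
  apply: (@parity_flip R 4 x n s d) => // l hl el; apply: f; split=> // i.
  by rewrite -(subrK (n i) (l 0 i)); apply: rpredD.
set Q := \sum_i d i ^+ 2 in ev od.
have hA i : t + 2 * d i <= Q.
  have /andP[d0 d1] := d01 i.
  have [/ev h|/od /(_ i) h] := boolP ((\sum_i n i) / 2 \is a Num.int); lra.
have W : 0 <= \sum_i d i * (Q - 2 * d i - t).
  apply: sumr_ge0 => i _; have /andP[d0 d1] := d01 i; apply: mulr_ge0 => //.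
  by have := hA i; lra.
pose S := \sum_i d i.
have WE : \sum_i d i * (Q - 2 * d i - t) = Q * (S - 2) - t * S.
  rewrite /S (_ : Q * (_ - 2) = Q * (\sum_i d i) - 2 * \sum_i d i ^+ 2); last first.
    by rewrite -/Q; ring.
  by clearbody Q; rewrite !big_ord_recl !big_ord0; ring.
have eS : \sum_i (1/2 - d i) = 2 - S by rewrite /S !big_ord_recl !big_ord0; field.
have e0 i : 0 <= 1/2 - d i by have /andP[d0 d1] := d01 i; lra.
have S2 : 0 <= 2 - S by rewrite -eS sumr_ge0.
have S0 : 0 <= S by apply: sumr_ge0 => i _; have /andP[] := d01 i.
have Q0 : 0 <= Q by apply: sumr_ge0 => i _; apply: sqr_ge0.
have tS : 0 <= t * S by apply: mulr_ge0.
have QS : 0 <= Q * (2 - S) by apply: mulr_ge0.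
have /eqP tS0 : t * S = 0 by move: W; rewrite WE; lra.
have /eqP : Q * (2 - S) = 0 by move: W; rewrite WE; lra.
rewrite mulf_eq0 => /orP[] /eqP h.
  have dz i : d i = 0 by have := hA i; have /andP[] := d01 i; lra.
  split; first by have := hA ord0; have /andP[] := d01 ord0; lra.
  by left=> i; rewrite xE dz mulr0 addr0.
split; first by move: tS0; rewrite mulf_eq0 => /orP[] /eqP; lra.
have dh i : d i = 1/2.
  move/eqP: h; rewrite -eS psumr_eq0 // => /allP /(_ i (mem_index_enum _)) /eqP /=; lra.
right=> i; rewrite xE dh; case: (s1 i) => ->; rewrite ?mul1r ?mulN1r.
  by rewrite addrK.
rewrite (_ : _ - _ = n i - 1); last by field.
by rewrite rpredB ?rpred1.
Qed.

(* Representatives modulo L of the lattice points and the deep holes (lists are padded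
   with zeros); the E8 entry is a junk value. *)
Definition hole_reps (L : lat) : seq (seq R) :=
  match L with
  | A1 => [:: [::]; [:: 1/2; -1/2]]
  | A2 => [:: [::]; [:: 1/3; 1/3; -2/3]; [:: 2/3; -1/3; -1/3]]
  | D4 => [:: [::]; [:: 1]; [:: 1/2; 1/2; 1/2; 1/2]; [:: 1/2; 1/2; 1/2; -1/2]]
  | E8 => [::]
  end.

Definition hole (L : lat) (i : nat) : @vec R L := mkrow (amb L) (nth [::] (hole_reps L) i).

Lemma hole0 (L : lat) : hole L 0 = 0.
Proof. by apply/rowP => i; rewrite !mxE; case: L i => i; rewrite /= nth_nil. Qed.

(** These are the four classes of the dual of D4 modulo D4: integral or half-integral, each split by
    a parity. *)
Lemma hole_D4 (x : @vec R D4) : all_int R x \/ all_halfint R x ->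
  exists i : 'I_4, teq D4 x (hole D4 i).
Proof.
have key (i : 'I_4) (a : R) (y : 'rV[R]_4) : a = 1 \/ a = -1 -> all_int R y -> exists b : bool,
    lattice D4 (y - if b then a *: delta_mx 0 i else 0).
  move=> ha hy; have hs : csum R y \is a Num.int by apply: rpred_sum.
  case: (intr_parity _ hs) => h; [exists false|exists true]; split=> /=.
  - by rewrite subr0.
  - by rewrite subr0.
  - move=> j; rewrite !mxE /=; apply: rpredB => //; apply: rpredM; last exact: rpred_nat.
    by case: ha => ->; rewrite ?rpredN rpred1.
  - rewrite csumB csumZ (_ : csum R (delta_mx _ _) = 1); last first.
      rewrite /csum (bigD1 i) //= big1 ?addr0 ?mxE ?eqxx // => j /negPf ji.
      by rewrite mxE ji andbF.
    case: ha => ->; rewrite mulr1 //.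
    rewrite (_ : _ / 2 = (csum R y - 1) / 2 + 1); last by field.
    by apply: rpredD; rewrite ?rpred1.
case=> hx.
  have [b hb] := key ord0 1 x (or_introl erefl) hx; exists (inord b); rewrite inordK; last by case: b hb.
  rewrite /teq; congr (lattice D4 _): hb; congr (_ - _).
  by case: b; apply/rowP; case; case=> [|[|[|[|]]]] //= ?; rewrite !mxE /= ?mulr1 ?mulr0.
have hx' : all_int R (x - const_mx 2^-1) by move=> i; rewrite !mxE; apply: hx.
(* The sign -1 at the last coordinate matches the fourth representative: all entries 1/2, minus the
   last unit vector. *)
have [b hb] := key ord_max (-1) _ (or_intror erefl) hx'.
exists (inord (2 + b)); rewrite inordK; last by case: b hb.
rewrite /teq; congr (lattice D4 _): hb; rewrite -addrA -opprD; congr (_ - _).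
case: b; apply/rowP; case; case=> [|[|[|[|]]]] //= ?; rewrite !mxE /=; by field.
Qed.

End HoleClasses.

(** * Deep holes of A1 and A2, and the covering bound *)

Section Covering.
Context {R : realType}.

Lemma floor_frac (x : R) : exists n f : R, [/\ n \is a Num.int, 0 <= f < 1 & x = n + f].
Proof.
exists (Num.floor x)%:~R, (x - (Num.floor x)%:~R).
have := floor_le x; have := floorD1_gt x; rewrite intrD => h1 h2.
by split; [exact: intr_int|apply/andP; split; lra|ring].
Qed.

Lemma far_A1 (x : @vec R A1) (t : R) : amb_space A1 x -> 0 <= t ->
  far A1 (1/2 + t) x -> t = 0 /\ teq A1 x (hole A1 1).
Proof.
move=> ax t0 fx.
have x0 : x 0 ord0 + x 0 (lift ord0 ord0) = 0.
  by move: ax; rewrite /= /csum !big_ord_recl big_ord0 addr0.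
have [n [f [nint f01 xE]]] := floor_frac (x 0 ord0).
have /andP[f0 f1] := f01.
have inL (m : R) : m \is a Num.int -> lattice A1 (mkrow 2 [:: m; -m]).
  move=> hm; split.
    by case; case=> [|[|]] //= ?; rewrite mxE /= ?rpredN.
  by rewrite /csum !big_ord_recl big_ord0 !mxE /= addr0 subrr.
have xE' : x 0 (lift ord0 ord0) = - n - f by move: x0; rewrite xE; lra.
have dE (m : R) : dot (x - mkrow 2 [:: m; -m]) (x - mkrow 2 [:: m; -m])
    = 2 * (n + f - m) ^+ 2.
  by rewrite /dot !big_ord_recl big_ord0 !mxE /= xE xE'; ring.
have := fx _ (inL _ nint); rewrite dE => h1.
have n1 : n + 1 \is a Num.int by rewrite rpredD ?rpred1.
have := fx _ (inL _ n1); rewrite dE => h2.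
have fh : f = 1/2 by nra.
split; first by move: h1; rewrite fh; nra.
rewrite /teq (_ : x - hole A1 1 = mkrow 2 [:: n; -n]); first exact: inL.
by apply/rowP; case; case=> [|[|]] //= hi; rewrite !mxE /=;
  [rewrite (_ : Ordinal hi = ord0)|rewrite (_ : Ordinal hi = lift ord0 ord0)];
  rewrite ?xE ?xE' ?fh; try exact: val_inj; field.
Qed.

(** [a], [b], [c] are barycentric coordinates in the triangle of unit vectors. By Leibniz's relation
    the average, with these weights, of the squared distances to the vertices is 2/3 minus the
    squared distance to the centroid. *)
Lemma A2_hole_ineq (a b c t : R) : 0 <= t -> 0 <= a -> 0 <= b -> 0 <= c -> a + b + c = 1 ->
  2/3 + t <= (a - 1) ^+ 2 + b ^+ 2 + c ^+ 2 ->
  2/3 + t <= a ^+ 2 + (b - 1) ^+ 2 + c ^+ 2 ->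
  2/3 + t <= a ^+ 2 + b ^+ 2 + (c - 1) ^+ 2 ->
  [/\ t = 0, a = 1/3, b = 1/3 & c = 1/3].
Proof.
move=> t0 a0 b0 c0 s ha hb hc.
have W : 0 <= a * ((a - 1) ^+ 2 + b ^+ 2 + c ^+ 2 - 2/3 - t)
      + b * (a ^+ 2 + (b - 1) ^+ 2 + c ^+ 2 - 2/3 - t)
      + c * (a ^+ 2 + b ^+ 2 + (c - 1) ^+ 2 - 2/3 - t).
  by rewrite !addr_ge0 // mulr_ge0 //; lra.
have cE : c = 1 - a - b by lra.
have E : t + ((a - 1/3) ^+ 2 + (b - 1/3) ^+ 2 + (c - 1/3) ^+ 2) <= 0.
  have -> : t + ((a - 1/3) ^+ 2 + (b - 1/3) ^+ 2 + (c - 1/3) ^+ 2) =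
    - (a * ((a - 1) ^+ 2 + b ^+ 2 + c ^+ 2 - 2/3 - t)
      + b * (a ^+ 2 + (b - 1) ^+ 2 + c ^+ 2 - 2/3 - t)
      + c * (a ^+ 2 + b ^+ 2 + (c - 1) ^+ 2 - 2/3 - t)) by rewrite cE; field.
  by lra.
have z (y : R) : y ^+ 2 = 0 -> y = 0 by move/eqP; rewrite sqrf_eq0 => /eqP.
have := sqr_ge0 (a - 1/3); have := sqr_ge0 (b - 1/3); have := sqr_ge0 (c - 1/3).
move=> h1 h2 h3; split; first lra.
- by have := z (a - 1/3) ltac:(lra); lra.
- by have := z (b - 1/3) ltac:(lra); lra.
- by have := z (c - 1/3) ltac:(lra); lra.
Qed.

(** The fractional parts add up to 0, 1 or 2: a lattice point, or one of the two triangles that make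
    up a fundamental parallelogram. The substitution of [1 - f] for [f] exchanges the triangles, and
    their centroids are the two deep holes. *)
Lemma far_A2 (x : @vec R A2) (t : R) : amb_space A2 x -> 0 <= t ->
  far A2 (2/3 + t) x -> t = 0 /\ exists i : 'I_3, teq A2 x (hole A2 i).
Proof.
move=> ax t0 fx; pose i1 := lift ord0 ord0 : 'I_3; pose i2 := lift ord0 (lift ord0 ord0) : 'I_3.
have x0 : x 0 ord0 + (x 0 i1 + x 0 i2) = 0.
  by move: ax; rewrite /= /csum !big_ord_recl big_ord0 addr0.
have [n [f [nint /andP[f0 f1] xE]]] := floor_frac (x 0 ord0).
have [n' [f' [nint' /andP[f0' f1'] xE']]] := floor_frac (x 0 i1).
have [n'' [f'' [nint'' /andP[f0'' f1''] xE'']]] := floor_frac (x 0 i2).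
have inL (a b c : R) : a \is a Num.int -> b \is a Num.int -> c \is a Num.int ->
    a + b + c = 0 -> lattice A2 (mkrow 3 [:: a; b; c]).
  move=> ha hb hc s; split.
    by case; case=> [|[|[|]]] //= ?; rewrite mxE.
  by rewrite /csum !big_ord_recl big_ord0 !mxE /= addr0 addrA.
have dE (a b c : R) : dot (x - mkrow 3 [:: a; b; c]) (x - mkrow 3 [:: a; b; c])
    = (n + f - a) ^+ 2 + (n' + f' - b) ^+ 2 + (n'' + f'' - c) ^+ 2.
  by rewrite /dot !big_ord_recl big_ord0 !mxE /= xE xE' xE''; ring.
have fL (a b c : R) : a \is a Num.int -> b \is a Num.int -> c \is a Num.int ->
    a + b + c = f + f' + f'' ->
    2/3 + t <= (f - a) ^+ 2 + (f' - b) ^+ 2 + (f'' - c) ^+ 2.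
  move=> ha hb hc s.
  have := fx _ (inL (n + a) (n' + b) (n'' + c) _ _ _ _); rewrite dE.
  rewrite !opprD !addrA ![_ + _ - n]addrAC ![_ + _ - n']addrAC ![_ + _ - n'']addrAC !subrr !add0r.
  by apply; try exact: rpredD; move: x0; rewrite xE xE' xE''; lra.
have i0 : (0 : R) \is a Num.int := rpred0 _.
have ii1 : (1 : R) \is a Num.int := rpred1 _.
have rE (a b c : R) : f = a -> f' = b -> f'' = c -> x = mkrow 3 [:: n + a; n' + b; n'' + c].
  move=> ha hb hc; apply/rowP; case; case=> [|[|[|]]] //= hi; rewrite mxE /=.
  - by rewrite -ha -xE; congr (x 0 _); apply: val_inj.
  - by rewrite -hb -xE'; congr (x 0 _); apply: val_inj.
  - by rewrite -hc -xE''; congr (x 0 _); apply: val_inj.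
have sint : f + f' + f'' \is a Num.int.
  rewrite (_ : _ + _ + _ = - (n + n' + n'')); last by move: x0; rewrite xE xE' xE''; lra.
  by rewrite rpredN !rpredD.
have [s|s|s] : [\/ f + f' + f'' = 0, f + f' + f'' = 1 | f + f' + f'' = 2].
  move/intrP: sint => [z hz].
  have z0 : 0 <= z by rewrite -(ler_int R) -hz; lra.
  have z3 : z < 3 by rewrite -(ltr_int R) -hz; lra.
  rewrite hz.
  have [->|->|->] : [\/ z = 0, z = 1 | z = 2].
    by case: z {hz} z0 z3 => [[|[|[|]]]|] // _ _; [constructor 1|constructor 2|constructor 3].
  - by constructor 1.
  - by constructor 2.
  - by constructor 3.
- have e1 : f = 0 by lra.
  have e2 : f' = 0 by lra.
  have e3 : f'' = 0 by lra.
  have := fL 0 0 0 i0 i0 i0; rewrite !addr0 s e1 e2 e3 subrr expr0n /= => /(_ erefl); lra.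
- have h1 := fL 1 0 0 ii1 i0 i0; have h2 := fL 0 1 0 i0 ii1 i0; have h3 := fL 0 0 1 i0 i0 ii1.
  rewrite !subr0 !addr0 ?add0r s in h1 h2 h3.
  have [-> e1 e2 e3] := A2_hole_ineq f f' f'' t t0 f0 f0' f0'' s (h1 erefl) (h2 erefl) (h3 erefl).
  split=> //; exists (inord 1); rewrite inordK // (rE _ _ _ e1 e2 e3) /teq.
  rewrite (_ : _ - _ = mkrow 3 [:: n; n'; n'' + 1]).
    by apply: inL; rewrite ?rpredD //; move: x0; rewrite xE xE' xE''; lra.
  apply/rowP; case; case=> [|[|[|]]] //= hi; rewrite !mxE /=; by field.
have h1 := fL 0 1 1 i0 ii1 ii1; have h2 := fL 1 0 1 ii1 i0 ii1; have h3 := fL 1 1 0 ii1 ii1 i0.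
rewrite s in h1 h2 h3.
have [|||||||t00 e1 e2 e3] := A2_hole_ineq (1 - f) (1 - f') (1 - f'') t t0; try lra.
split=> //; exists (inord 2); rewrite inordK // /teq (rE (2/3) (2/3) (2/3)); [|lra..].
rewrite (_ : _ - _ = mkrow 3 [:: n; n' + 1; n'' + 1]).
  by apply: inL; rewrite ?rpredD //; move: x0; rewrite xE xE' xE''; lra.
apply/rowP; case; case=> [|[|[|]]] //= hi; rewrite !mxE /=; by field.
Qed.

Definition rho2 (L : lat) : R := match L with A1 => 1/2 | A2 => 2/3 | D4 | E8 => 1 end.

(** These are the values of n_L, namely q^(m/2) where [2 q] = 8, 6, 4, 4 is the second smallest
    norm; see [is_nL_nval]. *)
Definition nval (L : lat) : nat := match L with A1 => 2 | A2 => 3 | D4 => 4 | E8 => 16 end.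

Lemma rho2_gt0 L : 0 < rho2 L.
Proof. by case: L => /=; lra. Qed.

(** The slack [t] lets one computation serve twice: [t = 0] is the covering bound, and the case
    [t = 0] of the lemmas used here describes the deep holes. *)
Lemma covering (L : lat) (x : @vec R L) (t : R) : amb_space L x -> 0 <= t ->
  far L (rho2 L + t) x -> t = 0.
Proof.
case: L x => x ax t0 fx.
- by have [] := far_A1 x t ax t0 fx.
- by have [] := far_A2 x t ax t0 fx.
- by have [] := far_D4 x t t0 fx.
- by have [] := far_E8 x t t0 fx.
Qed.

Lemma far_hole (L : lat) (x : @vec R L) : L <> E8 -> amb_space L x ->
  far L (rho2 L) x -> exists i : 'I_(nval L), teq L x (hole L i).
Proof.
move=> LE ax; rewrite -[rho2 L]addr0; case: L x ax LE => x ax //= _ fx.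
- by exists (inord 1); rewrite inordK //; have [] := far_A1 x 0 ax (lexx 0) fx.
- by have [] := far_A2 x 0 ax (lexx 0) fx.
- by have [_ /hole_D4] := far_D4 x 0 (lexx 0) fx.
Qed.

Lemma tdist_covering (L : lat) (x y : @vec R L) : amb_space L x -> amb_space L y ->
  tdist L x y <= Num.sqrt (rho2 L).
Proof.
move=> hx hy; have r0 := rho2_gt0 L.
have d0 := tdist_ge0 L x y.
have [//|h] := leP (tdist L x y) (Num.sqrt (rho2 L)).
have := (tdist_ge L x y _ d0).1 (lexx _).
have : rho2 L < tdist L x y ^+ 2.
  by rewrite -(sqr_sqrtr (ltW r0)) ltr_sqr ?nnegrE ?sqrtr_ge0.
move=> h2 fx; have := covering L (x - y) (tdist L x y ^+ 2 - rho2 L) (ambB _ _ _ hx hy).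
by rewrite subrKC => /(_ ltac:(lra) fx); lra.
Qed.

End Covering.

(** * Decidable membership, and short lattice vectors for the pigeonhole *)

Section ShortFamily.
Context {R : realType}.

(* Vectors with coordinates in (1/2)Z are stored as the integer lists of their doubles. *)
Definition halfrow k (a : seq int) : 'rV[R]_k := \row_(j < k) ((nth 0 a j)%:~R / 2).

Definition zsum k (a : seq int) : int := foldr (fun j s => nth 0 a j + s) 0 (iota 0 k).

Definition zdist2 k (a b : seq int) : int :=
  foldr (fun j s => (nth 0 a j - nth 0 b j) * (nth 0 a j - nth 0 b j) + s) 0 (iota 0 k).

(** The entries are doubled coordinates: evenness of an entry means integrality, and divisibility of
    the sum by 4 means an even coordinate sum. *)
Definition zlattice (L : lat) (a : seq int) : bool :=
  let odds := [seq odd `|nth 0 a j| | j <- iota 0 (amb L)] in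
  match L with
  | A1 | A2 => all negb odds && (zsum (amb L) a == 0)
  | D4 => all negb odds && (4 %| `|zsum (amb L) a|)%N
  | E8 => (all negb odds || all id odds) && (4 %| `|zsum (amb L) a|)%N
  end.

Lemma sum_ord_foldr (V : nmodType) k (F : nat -> V) :
  \sum_(j < k) F j = foldr (fun j s => F j + s) 0 (iota 0 k).
Proof. by rewrite -(big_mkord xpredT F) unlock /= /index_iota subn0. Qed.

Lemma csum_halfrow k a : csum R (halfrow k a) = (zsum k a)%:~R / 2.
Proof.
rewrite /zsum -(sum_ord_foldr _ k (fun j => nth 0 a j)) raddf_sum mulr_suml.
by apply: eq_bigr => j _; rewrite mxE.
Qed.

Lemma dot_halfrow k a b :
  dot (halfrow k a - halfrow k b) (halfrow k a - halfrow k b) = (zdist2 k a b)%:~R / 4.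
Proof.
rewrite /zdist2 -(sum_ord_foldr _ k (fun j => (nth 0 a j - nth 0 b j) * (nth 0 a j - nth 0 b j))).
rewrite raddf_sum mulr_suml; apply: eq_bigr => j _.
by rewrite !mxE /= intrM intrB; field.
Qed.

Lemma half_int (z : int) : (z%:~R / 2 : R) \is a Num.int = ~~ odd `|z|.
Proof.
apply/idP/idP => [/intrP[q hq]|h].
  have : z%:~R = (2 * q)%:~R :> R by rewrite intrM -hq; field.
  by move/eqP; rewrite eqr_int => /eqP; lia.
apply/intrP; exists (z %/ 2)%Z.
have -> : z%:~R = (2 * (z %/ 2)%Z)%:~R :> R by congr (_%:~R); lia.
by rewrite intrM; field.
Qed.

Lemma half_halfint (z : int) : (z%:~R / 2 - 2^-1 : R) \is a Num.int = odd `|z|.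
Proof.
rewrite (_ : _ - _ = (z - 1)%:~R / 2); last by rewrite intrB; field.
by rewrite half_int; lia.
Qed.

Lemma quarter_int (z : int) : (z%:~R / 2 / 2 : R) \is a Num.int = (4 %| `|z|)%N.
Proof.
apply/idP/idP => [/intrP[q hq]|h].
  have : z%:~R = (4 * q)%:~R :> R by rewrite intrM -hq; field.
  by move/eqP; rewrite eqr_int => /eqP; lia.
apply/intrP; exists (z %/ 4)%Z.
have -> : z%:~R = (4 * (z %/ 4)%Z)%:~R :> R by congr (_%:~R); lia.
by rewrite intrM; field.
Qed.

Lemma all_odds k a (p : bool -> bool) :
  reflect (forall j : 'I_k, p (odd `|nth 0 a j|))
    (all p [seq odd `|nth 0 a j| | j <- iota 0 k]).
Proof.
rewrite all_map; apply: (iffP allP) => h j.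
  by apply: h; rewrite mem_iota /= ltn_ord.
by rewrite mem_iota /= => hj; apply: (h (Ordinal hj)).
Qed.

Lemma lattice_halfrow (L : lat) a : lattice L (halfrow (amb L) a) <-> zlattice L a.
Proof.
have I k : all_int R (halfrow k a) <-> all negb [seq odd `|nth 0 a j| | j <- iota 0 k].
  split=> [h|/all_odds h]; first apply/all_odds; move=> j; have := h j;
    by rewrite ?mxE half_int.
have H k : all_halfint R (halfrow k a) <-> all id [seq odd `|nth 0 a j| | j <- iota 0 k].
  split=> [h|/all_odds h]; first apply/all_odds; move=> j; have := h j;
    by rewrite ?mxE half_halfint.
have S k : csum R (halfrow k a) = 0 <-> zsum k a == 0.
  rewrite csum_halfrow; split=> [/eqP|/eqP ->]; last by rewrite mul0r.
  by rewrite mulf_eq0 invr_eq0 pnatr_eq0 orbF intr_eq0.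
have S4 k : (csum R (halfrow k a) / 2 \is a Num.int) = (4 %| `|zsum k a|)%N.
  by rewrite csum_halfrow quarter_int.
case: L; cbv beta iota zeta delta [lattice zlattice amb mkset]; rewrite ?S4; split.
1,3: by move=> [/I h1 /S h2]; apply/andP.
1,2: by move=> /andP[/I h1 /S h2].
- by move=> [/I h1 h2]; apply/andP.
- by move=> /andP[/I h1 h2].
- by move=> [[/I|/H] h1 h2]; apply/andP; split=> //; apply/orP; [left|right].
- by move=> /andP[/orP[/I|/H] h1 h2]; split=> //; [left|right].
Qed.

(** Doubled coordinates. A1: three consecutive points; A2: a rhombus of two triangles; D4: five
    vertices of the cross-polytope e0 + e_j, e0 - e_j around the hole e0; E8: all sixteen vertices
    of that cross-polytope (0 and 2 e0 included) and the vector with all entries 1/2. *)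
Definition short_table (L : lat) : seq (seq int) :=
  match L with
  | A1 => [:: [::]; [:: 2; -2]; [:: -2; 2]]
  | A2 => [:: [::]; [:: 2; -2; 0]; [:: 2; 0; -2]; [:: 0; 2; -2]]
  | D4 => [:: [::]; [:: 2; 2]; [:: 2; -2]; [:: 2; 0; 2]; [:: 2; 0; -2]]
  | E8 => [:: [::]; [:: 4]; nseq 8 1] ++
      [seq 2 :: nseq j 0 ++ [:: 2] | j <- iota 0 7] ++
      [seq 2 :: nseq j 0 ++ [:: -2] | j <- iota 0 7]
  end.

(* More lattice vectors than code points, pairwise so close that a similarity of
   ratio s with 2 s^2 < rho^2 would make all of them distinct modulo L. *)
Lemma short_family (L : lat) : exists S : 'I_(nval L).+1 -> @vec R L,
  (forall i, lattice L (S i)) /\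
  (forall i j, i != j -> S i != S j /\ dot (S i - S j) (S i - S j) * rho2 L <= 4).
Proof.
pose tab := nth [::] (short_table L).
(* The bound [4 / rho2 L] on squared distances, times 4 because coordinates are doubled. *)
pose bd : int := match L with A1 => 32 | A2 => 24 | _ => 16 end.
have bdE : bd%:~R / 4 * rho2 L = 4 :> R by rewrite /bd /rho2; case: (L); field.
exists (fun i => halfrow (amb L) (tab i)); split=> [i|i j ij].
  apply/lattice_halfrow.
  have : all (zlattice L) (short_table L) by case: (L); vm_compute.
  move/allP; apply; apply: mem_nth.
  by rewrite (leq_trans (ltn_ord i)) //; case: (L).
have : all (fun i => all (fun j => (i == j) ||
    (0 < zdist2 (amb L) (tab i) (tab j) <= bd)) (iota 0 (nval L).+1)) (iota 0 (nval L).+1).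
  by rewrite /tab /bd; case: (L); vm_compute.
move/allP/(_ i); rewrite mem_iota ltn_ord => /(_ isT) /allP /(_ j).
rewrite mem_iota ltn_ord => /(_ isT); rewrite (negPf (ij : (i != j :> nat))) /=.
move=> /andP[d0 d1]; split.
  apply/eqP => e; have := dot_halfrow (amb L) (tab i) (tab j).
  rewrite e subrr dot0 => /eqP; rewrite eq_sym mulf_eq0 invr_eq0 pnatr_eq0 orbF intr_eq0.
  by move/eqP => h; rewrite h in d0.
rewrite dot_halfrow -{2}bdE ler_wpM2r //; first exact/ltW/rho2_gt0.
by rewrite ler_wpM2r ?invr_ge0 // ler_int.
Qed.

End ShortFamily.

(** * Codes with all distances rho, torus isometries, and the scale of T *)

Section Codes.
Context {R : realType}.

Definition spread (L : lat) k (c : 'I_k -> @vec R L) :=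
  forall i j, i != j -> far L (rho2 L) (c i - c j).

Lemma far_nlattice (L : lat) (r : R) (x : @vec R L) : 0 < r -> far L r x -> ~ lattice L x.
Proof. by move=> r0 fx /fx; rewrite subrr dot0 leNgt r0. Qed.

Lemma rho_ge0 L : 0 <= Num.sqrt (@rho2 R L). Proof. exact: sqrtr_ge0. Qed.

Lemma rho_sqr L : Num.sqrt (@rho2 R L) ^+ 2 = rho2 L.
Proof. by rewrite sqr_sqrtr // ltW // rho2_gt0. Qed.

Lemma spread_tdist (L : lat) k (c : 'I_k -> @vec R L) :
  spread L k c <-> forall i j, i != j -> Num.sqrt (rho2 L) <= tdist L (c i) (c j).
Proof.
by split=> h i j /h; [move=> f; apply/tdist_ge; rewrite ?rho_ge0 ?rho_sqr
  |move/(tdist_ge _ _ _ _ (rho_ge0 L)); rewrite rho_sqr].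
Qed.

Lemma spread_is_code (L : lat) k (c : 'I_k -> @vec R L) :
  (forall i, amb_space L (c i)) -> spread L k c -> is_code L k c.
Proof. by move=> ac sc; split=> // i j /sc /far_nlattice h; apply/h/rho2_gt0. Qed.

Lemma mindist_le (L : lat) k (c : 'I_k -> @vec R L) i j :
  i != j -> mindist L k c <= tdist L (c i) (c j).
Proof.
move=> ij; apply: ge_inf; last by exists (i, j).
by exists 0 => _ [ab _ <-]; apply: tdist_ge0.
Qed.

(** [1 < k] provides a pair of points; over an empty set of distances the infimum would be the
    default 0. *)
Lemma mindist_spread (L : lat) k (c : 'I_k -> @vec R L) : (1 < k)%N ->
  spread L k c -> Num.sqrt (rho2 L) <= mindist L k c.
Proof.
move=> k1 /spread_tdist h; apply: lb_le_inf.
  pose i : 'I_k := Ordinal (ltnW k1); pose j : 'I_k := Ordinal k1.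
  by exists (tdist L (c i) (c j)), (i, j).
by move=> _ [ab + <-]; apply: h.
Qed.

Lemma spread_optimal (L : lat) k (c : 'I_k -> @vec R L) : (1 < k)%N ->
  (forall i, amb_space L (c i)) -> spread L k c -> optimal_code L k c.
Proof.
move=> k1 ac sc; split=> [|c' [ac' _]]; first exact: spread_is_code.
apply: (le_trans _ (mindist_spread L k c k1 sc)).
apply: (le_trans (mindist_le L k c' (Ordinal (ltnW k1)) (Ordinal k1) _)) => //.
exact: tdist_covering.
Qed.

Lemma optimal_spread (L : lat) m k (c : 'I_m -> @vec R L) (c' : 'I_k -> @vec R L) :
  (k <= m)%N -> (forall i, amb_space L (c i)) -> spread L m c ->
  optimal_code L k c' -> spread L k c'.
Proof.
move=> km ac sc [_ oc]; apply/spread_tdist => i j ij.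
(* The pair [i != j] itself yields this bound, so the one-point codes that occur for A1 (n_L - 1 =
   1) need no separate case. *)
have k1 : (1 < k)%N.
  by have := ltn_ord i; have := ltn_ord j; move: ij; rewrite -val_eqE /=; lia.
pose c0 (a : 'I_k) := c (widen_ord km a).
have sc0 : spread L k c0 by move=> a b ab; apply: sc; rewrite -val_eqE.
apply: (le_trans (mindist_spread L k c0 k1 sc0)).
apply: (le_trans (oc c0 _)); last exact: mindist_le.
by apply: spread_is_code => // a; apply: ac.
Qed.

(** An involution preserving L permutes L, which gives both surjectivity and equality of the two
    infima. The identity covers translations; reflections are the other use. *)
Lemma linear_isometry (L : lat) (f : @vec R L -> @vec R L) (t : @vec R L) :
  {morph f : x y / x - y} -> (forall x, dot (f x) (f x) = dot x x) ->
  (forall x, amb_space L x -> amb_space L (f x)) ->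
  (forall x, lattice L x -> lattice L (f x)) -> involutive f -> amb_space L t ->
  torus_isometry L (fun x => f x + t).
Proof.
move=> fB fdot famb flat fK at0.
have fN x : norm2 R (f x) = norm2 R x by rewrite !norm2E fdot.
split; first by move=> x /famb h; apply: ambD.
split=> [x y _ _ h|]; first by rewrite /teq opprD addrACA subrr addr0 -fB; apply: flat.
split=> [x y _ _|y ay].
  have e : f x + t - (f y + t) = f (x - y) by rewrite fB opprD addrACA subrr addr0.
  rewrite /tdist e; congr inf; apply/seteqP; split=> _ [l hl <-].
    by exists (f l); [apply: flat|rewrite -[in RHS](fK l) -fB fN].
  by exists (f l); [apply: flat|rewrite -fB fN].
exists (f (y - t)); first by apply/famb/ambB.
by rewrite fK subrK; apply: teq_refl.
Qed.

Lemma translation_isometry (L : lat) (t : @vec R L) :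
  amb_space L t -> torus_isometry L (fun x => x + t).
Proof. by move=> h; apply: (linear_isometry L idfun). Qed.

Lemma isometry_comp (L : lat) (f g : @vec R L -> @vec R L) :
  torus_isometry L f -> torus_isometry L g -> torus_isometry L (f \o g).
Proof.
move=> [fa [ft [fd fs]]] [ga [gt [gd gs]]]; split; first by move=> x /ga /fa.
split; first by move=> x y ax ay h; apply: ft (gt _ _ ax ay h); apply: ga.
split; first by move=> x y ax ay; rewrite fd ?gd //; apply: ga.
move=> y /fs[z az hz]; have [x ax hx] := gs z az; exists x => //.
by apply: teq_trans hz; apply: ft => //; apply: ga.
Qed.

Section Image.
Context {L : lat} {T : 'M[R]_(amb L)} {s : R}.
Context (s0 : 0 < s).
Context (hT : forall v : @vec R L, amb_space L v ->
  amb_space L (v *m T) /\ norm2 R (v *m T) = s * norm2 R v).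
Context (LT : (lattice L `<=` image_lattice L T)%classic).

Lemma imageB x y : image_lattice L T x -> image_lattice L T y -> image_lattice L T (x - y).
Proof. by move=> [u hu <-] [v hv <-]; exists (u - v); [apply: latticeB|rewrite mulmxBl]. Qed.

Lemma image_teq x y : teq L x y -> image_lattice L T y -> image_lattice L T x.
Proof.
move=> /LT h hy; rewrite -(subrK y x) -[y in _ + y]opprK; apply: imageB => //.
by rewrite -sub0r; apply: imageB => //; apply/LT/lattice0.
Qed.

Lemma image_amb x : image_lattice L T x -> amb_space L x.
Proof. by move=> [u /lattice_amb hu <-]; have [] := hT u hu. Qed.

Lemma dot_image v : amb_space L v -> dot (v *m T) (v *m T) = s ^+ 2 * dot v v.
Proof. by move=> av; rewrite -!norm2_sqr (hT v av).2 exprMn. Qed.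

Lemma image_min x : image_lattice L T x -> x != 0 -> 2 * s ^+ 2 <= dot x x.
Proof.
move=> [u hu <-] ux; rewrite dot_image; last exact: lattice_amb.
rewrite mulrC ler_wpM2l ?sqr_ge0 //; apply: lattice_min => //.
by apply: contraNneq ux => ->; rewrite mul0mx.
Qed.

(** Since L lies in TL, [x - l] is a nonzero vector of TL. *)
Lemma image_far x : image_lattice L T x -> ~ lattice L x -> far L (2 * s ^+ 2) x.
Proof.
move=> hx nx l hl; apply: image_min; first by apply: imageB => //; apply: LT.
by apply/eqP => /eqP; rewrite subr_eq0 => /eqP e; apply: nx; rewrite e.
Qed.

(** By pigeonhole, two vectors of [short_family] have images congruent modulo L. Their difference
    [d] has a nonzero image in L, so [2 <= s^2 d.d <= 4 s^2 / rho2 L]. *)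
Lemma scale_ge (c : 'I_(nval L) -> @vec R L) :
  (forall x, image_lattice L T x -> exists i, teq L x (c i)) -> rho2 L <= 2 * s ^+ 2.
Proof.
move=> cT; have [S [SL Sd]] := @short_family R L.
have /choice[f hf] : forall i, exists j, teq L (S i *m T) (c j).
  by move=> i; apply: cT; exists (S i).
have [i [j [ij fij]]] : exists i j, i != j /\ f i = f j.
  apply: contrapT => h; suff /leq_card : injective f by rewrite !card_ord ltnn.
  move=> i j fij; apply/eqP/negPn/negP => ij; apply: h; by exists i, j.
have [Sij dij] := Sd i j ij.
have hL : lattice L ((S i - S j) *m T).
  rewrite mulmxBl; apply: teq_trans (hf i) _; rewrite fij; apply: teq_sym; exact: hf.
have aS : amb_space L (S i - S j) by apply: lattice_amb; apply: latticeB.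
have dS : 0 < dot (S i - S j) (S i - S j).
  rewrite lt_def dot_ge0 andbT; apply: contra Sij => /eqP /dot_eq0 /eqP.
  by rewrite subr_eq0.
have : 2 <= dot ((S i - S j) *m T) ((S i - S j) *m T).
  apply: lattice_min => //; apply/eqP => e; have := dot_image _ aS.
  by rewrite e dot0 => /eqP; rewrite eq_sym mulf_eq0 sqrf_eq0 !gt_eqF.
rewrite dot_image // => h2; have r0 := @rho2_gt0 R L.
rewrite -(ler_pM2r dS) mulrC (le_trans dij) //.
by lra.
Qed.

Lemma scale_le x : image_lattice L T x -> ~ lattice L x -> 2 * s ^+ 2 <= rho2 L.
Proof.
move=> hx nx; have fx := image_far x hx nx.
have [//|h] := leP (2 * s ^+ 2) (rho2 L).
have := covering L x (2 * s ^+ 2 - rho2 L) (image_amb x hx).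
by rewrite subrKC => /(_ ltac:(lra) fx); lra.
Qed.

End Image.

End Codes.

(** * Moving a code into the lattice code *)

Section Embedding.
Context {R : realType}.

(** Translating [c' i1] to 0 makes the other points deep holes. The points of [c] lie in distinct
    hole classes and are as many as the classes, so [c] meets each of them. *)
Lemma embed_holes (L : lat) k (c : 'I_(nval L) -> @vec R L) (c' : 'I_k -> @vec R L) i0 (i1 : 'I_k) :
  L <> E8 -> (forall i, amb_space L (c i)) -> spread L _ c -> lattice L (c i0) ->
  (forall i, amb_space L (c' i)) -> spread L _ c' ->
  exists g : @vec R L -> @vec R L, torus_isometry L g /\
    (forall i, exists j, teq L (g (c' i)) (c j)).
Proof.
move=> LE ac sc c0 ac' sc'.
have n0 : (0 < nval L)%N by case: (L).
have cls (x : @vec R L) : amb_space L x -> lattice L x \/ far L (rho2 L) x ->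
    exists i : 'I_(nval L), teq L x (hole L i).
  move=> ax [hx|]; last exact: far_hole.
  by exists (Ordinal n0); rewrite hole0 /teq subr0.
have /choice[f hf] : forall j, exists i : 'I_(nval L), teq L (c j) (hole L i).
  move=> j; apply: cls => //; have [->|ji] := eqVneq j i0; [by left|right].
  apply: far_teq (sc _ _ ji); rewrite /teq addrAC subrr sub0r; exact: latticeN.
have finj : injective f.
  move=> i j fij; apply/eqP/negPn/negP => ij.
  apply: (far_nlattice L _ _ (rho2_gt0 L) (sc i j ij)).
  by apply: teq_trans (hf i) _; rewrite fij; apply/teq_sym/hf.
exists (fun x => x + - c' i1); split.
  apply: translation_isometry; rewrite -sub0r; apply: ambB => //.
  exact/lattice_amb/lattice0.
move=> i; have [j hj] : exists j : 'I_(nval L), teq L (c' i - c' i1) (hole L j).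
  apply: cls; first exact: ambB.
  have [->|ii] := eqVneq i i1; [left|right; exact: sc'].
  by rewrite subrr; apply: lattice0.
have /codomP[j' ej] := inj_card_onto finj (leqnn _) j.
by exists j'; apply: teq_trans hj _; rewrite ej; apply/teq_sym/hf.
Qed.

(** The products with the vectors formed from two signed unit vectors make all coordinates congruent
    modulo 1 with integral doubles; the product with the vector of entries 1/2 makes the sum
    even. *)
Lemma E8_dual (y : @vec R E8) :
  (forall x, lattice E8 x -> dot y x \is a Num.int) -> lattice E8 y.
Proof.
move=> h.
have D (i j : 'I_8) (a b : R) : (a = 1 \/ a = -1) -> (b = 1 \/ b = -1) ->
    a * y 0 i + b * y 0 j \is a Num.int.
  move=> ha hb; have := h (a *: delta_mx 0 i + b *: delta_mx 0 j).
  have dd (l : 'I_8) : dot y (delta_mx 0 l) = y 0 l.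
    rewrite /dot (bigD1 l) //= big1 ?addr0 ?mxE ?eqxx ?mulr1 // => m /negPf ml.
    by rewrite mxE ml andbF mulr0.
  rewrite !dotE !dd; apply; split.
    left=> l; rewrite !mxE; apply: rpredD; apply: rpredM; rewrite ?rpred_nat //.
      by case: ha => ->; rewrite ?rpredN rpred1.
    by case: hb => ->; rewrite ?rpredN rpred1.
  have cd (l : 'I_8) : csum R (delta_mx 0 l : 'rV[R]_8) = 1.
    rewrite /csum (bigD1 l) //= big1 ?addr0 ?mxE ?eqxx // => m /negPf ml.
    by rewrite mxE ml andbF.
  rewrite csumD !csumZ !cd !mulr1; case: ha => ->; case: hb => ->.
  - by rewrite (_ : _ / _ = 1) ?rpred1 //; field.
  - by rewrite subrr mul0r rpred0.
  - by rewrite addNr mul0r rpred0.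
  - by rewrite (_ : _ / _ = -1) ?rpredN ?rpred1 //; field.
have pm (i : 'I_8) : y 0 i - y 0 ord0 \is a Num.int.
  by have := D i ord0 1 (-1) (or_introl erefl) (or_intror erefl); rewrite mul1r mulN1r.
have y2 : y 0 ord0 + y 0 ord0 \is a Num.int.
  by have := D ord0 ord0 1 1 (or_introl erefl) (or_introl erefl); rewrite mul1r.
split.
  have [h0|h0] := intr_parity _ y2; [left|right] => i.
    rewrite (_ : y 0 i = y 0 i - y 0 ord0 + (y 0 ord0 + y 0 ord0) / 2); last by field.
    exact: rpredD.
  rewrite (_ : _ - _ = y 0 i - y 0 ord0 + (y 0 ord0 + y 0 ord0 - 1) / 2); last by field.
  exact: rpredD.
have := h (const_mx 2^-1).
rewrite (_ : dot _ _ = csum R y / 2); last first.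
  by rewrite mulr_suml; apply: eq_bigr => i _; rewrite mxE.
apply; split; first by right=> i; rewrite mxE subrr rpred0.
rewrite (_ : csum _ _ / 2 = 2%:R); first exact: rpred_nat.
by rewrite /csum !big_ord_recl big_ord0 !mxE; field.
Qed.

(** The usual factor [2 / dot r r] is 1, as [r] will be a root. *)
Definition refl (r x : @vec R E8) : @vec R E8 := x - dot x r *: r.

Section Reflection.
Context (r : @vec R E8) (rL : lattice E8 r) (r2 : dot r r = 2).

Lemma reflB : {morph refl r : x y / x - y}.
Proof. by move=> x y; rewrite /refl !dotE scalerBl; apply/rowP => i; rewrite !mxE; ring. Qed.

Lemma reflK : involutive (refl r).
Proof. by move=> x; rewrite /refl !dotE r2; apply/rowP => i; rewrite !mxE; ring. Qed.

Lemma refl_dot x y : dot (refl r x) (refl r y) = dot x y.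
Proof. by rewrite /refl !dotE r2 (dotC r y); ring. Qed.

Lemma refl_lattice x : lattice E8 x -> lattice E8 (refl r x).
Proof. by move=> hx; apply: latticeB => //; apply: latticeZ => //; apply: lattice_dot_int. Qed.

Lemma refl_isometry : torus_isometry E8 (fun x => refl r x + 0).
Proof.
apply: linear_isometry => //; [exact: reflB|by move=> x; apply: refl_dot
 |exact: refl_lattice|exact: reflK].
Qed.

End Reflection.

(** Zeros of the quadratic form [x.x] mod 1 on (L/2)/L; its values lie in (1/2)Z/Z and its polar
    form is [2 x.y] mod 1. *)
Definition singular (x : @vec R E8) := lattice E8 (2 *: x) /\ dot x x \is a Num.int.

Lemma E8_near (x : @vec R E8) : lattice E8 (2 *: x) ->
  exists2 l, lattice E8 l & dot (x - l) (x - l) <= 1.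
Proof.
move=> hx; apply: contrapT => h.
have : far E8 (1 + 1/2) x.
  move=> l hl.
  have h1 : 1 < dot (x - l) (x - l).
    by rewrite ltNge; apply/negP => h1; apply: h; exists l.
  have h2 : lattice E8 (2 *: (x - l)).
    by rewrite scalerBr; apply: latticeB => //; apply: latticeZ => //; apply: rpred_nat.
  (* The norm of [x - l] is a half-integer, so above 1 it is at least 3/2, beyond the covering
     radius. *)
  have := intr_ge _ 2 (lattice_even _ _ h2).
  rewrite dotZl dotZr (_ : 2%:~R = 2) // (_ : (2 + 1)%:~R = 3) // => /(_ ltac:(lra)); lra.
by move=> /(far_E8 x (1/2) ltac:(lra)) []; lra.
Qed.

Lemma lattice_singular (x : @vec R E8) : lattice E8 x -> singular x.
Proof.
by move=> hx; split; [apply: latticeZ => //; apply: rpred_nat|apply: lattice_dot_int].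
Qed.

Lemma far_singular (x : @vec R E8) : far E8 1 x -> singular x.
Proof.
move=> fx; have [_ hx] := far_E8 x 0 (lexx 0) (eq_ind_r (fun r => far E8 r x) fx (addr0 1)).
split=> //; have [l hl nl] := E8_near x hx.
have e : dot (x - l) (x - l) = 1 by apply/eqP; rewrite eq_le nl fx.
rewrite (_ : dot x x = 1 + dot (2 *: x) l - dot l l); last first.
  by move: e; rewrite !dotE (dotC l x); lra.
by rewrite rpredB ?rpredD ?rpred1 ?lattice_dot_int.
Qed.

Section E8Image.
Context {T : 'M[R]_8} {s : R}.
Context (s0 : 0 < s).
Context (hT : forall v : @vec R E8, amb_space E8 v ->
  amb_space E8 (v *m T) /\ norm2 R (v *m T) = s * norm2 R v).
Context (LT : (lattice E8 `<=` image_lattice E8 T)%classic).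
Context (s2 : 2 * s ^+ 2 = 1).
Let M := image_lattice E8 T.

Lemma dot_image2 (u v : @vec R E8) : 2 * dot (u *m T) (v *m T) = dot u v.
Proof.
have h (w : @vec R E8) : dot (w *m T) (w *m T) = s ^+ 2 * dot w w by apply: (dot_image hT).
have := h (u + v); rewrite mulmxDl !dotE !h (dotC (v *m T)) (dotC v) => e.
have -> : dot u v = 2 * s ^+ 2 * dot u v by rewrite s2 mul1r.
by lra.
Qed.

Lemma image_singular x : M x -> singular x.
Proof.
move=> hx; have [lx|nx] := pselect (lattice E8 x); first exact: lattice_singular.
by apply: far_singular; rewrite -s2; apply: (image_far hT LT).
Qed.

Lemma image_dot x y : M x -> M y -> 2 * dot x y \is a Num.int.
Proof. by move=> [u hu <-] [v hv <-]; rewrite dot_image2; apply: lattice_dot_int. Qed.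

(** Since [2 s^2 = 1], the inverse of [T] is [2 T^T], and the preimage [2 u T^T] pairs integrally
    with E8, which is self-dual. This is the maximality of M. *)
Lemma image_dual (u : @vec R E8) : (forall x, M x -> 2 * dot u x \is a Num.int) -> M u.
Proof.
move=> h.
have dotT (x y : 'rV[R]_8) : dot x (y *m T) = dot (x *m T^T) y.
  rewrite dotC dot_mulmx dotC /dot; apply: eq_bigr => i _; rewrite !mxE; congr (_ * _).
  by apply: eq_bigr => j _; rewrite !mxE mulrC.
have TT : T *m ((2 : R) *: T^T) = 1%:M.
  apply/matrixP => i j; have := dot_image2 (delta_mx 0 i) (delta_mx 0 j).
  rewrite -!rowE {2}/dot (bigD1 i) //= big1 ?addr0; last first.
    by move=> l /negPf li; rewrite !mxE li andbF mul0r.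
  rewrite !mxE !eqxx /= mul1r => <-; rewrite /dot mulr_sumr; apply: eq_bigr => l _.
  by rewrite !mxE; ring.
exists (2 *: (u *m T^T)).
  apply: E8_dual => y hy; rewrite dotZl -dotT; apply: h; by exists y.
by rewrite -scalemxAl -mulmxA scalemxAr scalemxAl (mulmx1C TT) mulmx1.
Qed.

(* The root [r], congruent to [2 (u - u')] modulo [2 L], swaps [u] and [u'] modulo [L]
   and fixes modulo [L] every [w] with integral [2 w.u] and [2 w.u']. *)
Lemma swap_root (u u' : @vec R E8) : singular u -> singular u' ->
  2 * dot u u' \isn't a Num.int ->
  exists r, [/\ lattice E8 r, dot r r = 2, teq E8 (refl r u') u &
    forall w, lattice E8 (2 *: w) -> 2 * dot w u \is a Num.int ->
      2 * dot w u' \is a Num.int -> teq E8 (refl r w) w].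
Proof.
move=> [hu iu] [hu' iu'] nuu'; pose v := u - u'.
have hv : lattice E8 (2 *: v) by rewrite scalerBr; apply: latticeB.
have [l hl nl] := E8_near v hv.
have l2 : lattice E8 (2 *: l) by apply: latticeZ => //; apply: rpred_nat.
pose r := 2 *: (v - l).
have hr : lattice E8 r by rewrite /r scalerBr; apply: latticeB.
have wE (w : @vec R E8) : dot w r = 2 * dot w u - 2 * dot w u' - dot (2 *: w) l.
  by rewrite /r /v !dotE; ring.
have r2 : dot r r = 2.
  (* Modulo integers [r.r / 4] is [- 2 u.u'], hence not integral. As [r.r] is even and at most 4,
     the values 0 and 4 are excluded and 2 remains. *)
  have rE : dot r r / 2 / 2 = dot u u + dot u' u' - dot (2 *: v) l + dot l l - 2 * dot u u'.
    by rewrite /r /v !dotE (dotC l u) (dotC l u') (dotC u' u); field.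
  have odd_r : dot r r / 2 / 2 \isn't a Num.int.
    apply: contra nuu'; rewrite rE => h.
    rewrite -[2 * _]opprK rpredN.
    rewrite -(addrK (dot u u + dot u' u' - dot (2 *: v) l + dot l l) (- _)).
    rewrite addrC in h; apply: rpredB => //.
    apply: rpredD; last exact: lattice_dot_int.
    by apply: rpredB; [apply: rpredD|apply: lattice_dot_int].
  have le2 : dot r r / 2 <= 2 by move: nl; rewrite /r dotZl dotZr; lra.
  have := lattice_even _ _ hr; move: odd_r le2 (dot_ge0 r).
  move: (dot r r) => d odd_r le2 d0 /intrP[z hz].
  have z0 : 0 <= z by rewrite -(ler_int R) -hz; lra.
  have z2 : z <= 2 by rewrite -(ler_int R) -hz.
  case: z hz z0 z2 => [[|[|[|]]]|] // hz _ _; rewrite hz in odd_r.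
  - by rewrite mul0r rpred0 in odd_r.
  - by move: hz; rewrite (_ : 1%:~R = 1) //; lra.
  - by rewrite divff ?rpred1 ?pnatr_eq0 in odd_r.
exists r; split=> // [|w hw wu wu'].
  (* [p] differs from [2 u.u'] by an integer and [2 p] is integral, so [p] is in Z + 1/2. Then
     [refl r u'] is [u' - r/2] modulo L, which is [-u], which is [u] because [2 u] lies in L. *)
  pose p := dot u' r.
  have p2 : 2 * p \is a Num.int by rewrite -dotZl; apply: lattice_dot_int.
  have np : p \isn't a Num.int.
    apply: contra nuu'; rewrite /p wE (dotC u' u) => h.
    rewrite -(subrK (2 * dot u' u' + dot (2 *: u') l) (2 * dot u u')).
    apply: rpredD; first by rewrite opprD addrA.
    apply: rpredD; last exact: lattice_dot_int.
    by apply: rpredM => //; apply: rpred_nat.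
  have ph : p - 2^-1 \is a Num.int.
    have [h|] := intr_parity _ p2.
      by move: np; rewrite (_ : p = 2 * p / 2) ?h //; field.
    by rewrite (_ : (2 * p - 1) / 2 = p - 2^-1) //; field.
  rewrite /teq (_ : _ - _ = 2 *: u' - 2 *: u + l - (p - 2^-1) *: r).
    by apply: latticeB; [apply: latticeD => //; apply: latticeB|apply: latticeZ].
  by rewrite /refl -/p /r /v; apply/rowP => i; rewrite !mxE; field.
rewrite /teq /refl addrAC subrr sub0r; apply: latticeN; apply: latticeZ => //.
by rewrite wE !rpredB // lattice_dot_int.
Qed.

Lemma embed_E8 k (c : 'I_k -> @vec R E8) :
  (forall i, singular (c i)) -> (forall i j, 2 * dot (c i) (c j) \is a Num.int) ->
  exists g, torus_isometry E8 g /\ forall i, M (g (c i)).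
Proof.
move: {2}#|_| (leqnn #|[set i | ~~ `[< M (c i) >]]%SET|) => N.
elim: N c => [|N IH] c cN sc dc.
  exists (fun x => x + 0); split; first by apply: translation_isometry.
  move=> i; rewrite addr0; apply: contrapT => ni.
  move: cN; rewrite leqn0 cards_eq0 => /eqP/setP/(_ i); rewrite !inE.
  by move/negbT; rewrite negbK => /asboolP.
have [allM|] := pselect (forall i, M (c i)).
  exists (fun x => x + 0); split; first by apply: translation_isometry.
  by move=> i; rewrite addr0.
move/existsNP => [i ni].
have [u Mu nu] : exists2 u, M u & 2 * dot u (c i) \isn't a Num.int.
  apply: contrapT => h; apply/ni/image_dual => x Mx; apply/negPn/negP => nx.
  by apply: h; exists x => //; rewrite dotC.
have [r [rL r2 ru rw]] := swap_root u (c i) (image_singular _ Mu) (sc i) nu.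
have iso := refl_isometry r rL r2.
have [|||g [gi gM]] := IH (refl r \o c).
(* The induction counts the points outside M: those inside pair integrally with [u] ([image_dot])
   and with [c i], so they keep their classes, while [c i] enters M. *)
- rewrite -ltnS; apply: leq_trans cN; apply: proper_card; apply/properP; split.
    apply/fintype.subsetP => j; rewrite !inE; apply: contra => /asboolP Mj; apply/asboolP => /=.
    apply: (image_teq LT) (Mj); apply: rw; first by have [] := sc j.
      exact: image_dot.
    exact: dc.
  exists i; rewrite !inE; first by apply/asboolP.
  by rewrite negbK; apply/asboolP; apply: (image_teq LT) Mu.
- move=> j /=; have [h1 h2] := sc j; split; last by rewrite refl_dot.
  rewrite (_ : 2 *: refl r _ = refl r (2 *: c j)); first exact: refl_lattice.
  by rewrite /refl dotZl scalerBr scalerA.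
- by move=> a b /=; rewrite refl_dot.
exists (g \o (fun x => refl r x + 0)); split; first exact: isometry_comp.
by move=> j /=; rewrite addr0; apply: gM.
Qed.

End E8Image.
End Embedding.

(** * The value of n_L *)

Section Size.
Context {R : realType}.

Lemma ellE (L : lat) : @ell R L = Num.sqrt 2.
Proof.
pose a : seq int := match L with A1 | A2 => [:: 2; -2] | D4 | E8 => [:: 2; 2] end.
pose v : @vec R L := halfrow (amb L) a.
have vL : lattice L v by apply/lattice_halfrow; rewrite /a; case: (L).
have v2 : dot v v = 2.
  have h0 : halfrow (amb L) [::] = 0 :> 'rV[R]_(amb L).
    by apply/rowP => j; rewrite !mxE nth_nil mul0r.
  rewrite -[v]subr0 -h0 dot_halfrow (_ : zdist2 _ _ _ = 8); first by rewrite (_ : 8%:~R = 8) //; field.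
  by rewrite /a; case: (L).
apply/eqP; rewrite eq_le; apply/andP; split.
  rewrite -v2 -norm2E; apply: ge_inf.
    by exists 0 => _ [u _ <-]; apply: norm2_ge0.
  exists v => //; split=> //; apply/eqP => v0; move: v2; rewrite v0 dot0; lra.
apply: lb_le_inf.
  exists (norm2 R v), v => //; split=> //; apply/eqP => v0; move: v2; rewrite v0 dot0; lra.
by move=> _ [u [uL u0] <-]; rewrite norm2E ler_wsqrtr // lattice_min.
Qed.

Lemma NL_sqr (L : lat) (v : @vec R L) :
  (norm2 R ((ell L)^-1 *: v) ^+ dimL L) ^+ 2 = (dot v v / 2) ^+ dimL L.
Proof.
rewrite -!exprM mulnC exprM norm2_sqr dotZl dotZr ellE mulrA -expr2 exprVn.
by rewrite sqr_sqrtr ?ler0n // mulrC.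
Qed.

(** Half the norm is a square for A1 and a value of [a^2 + ab + b^2] for A2, a form that misses 2;
    for D4 and E8 integrality is enough. *)
Lemma norm_gap (L : lat) (v : @vec R L) : lattice L v -> v != 0 ->
  dot v v / 2 = 1 \/ (nval L)%:R ^+ 2 <= (dot v v / 2) ^+ dimL L.
Proof.
move=> vL v0; have qint := lattice_even L v vL; have q2 := lattice_min L v vL v0.
have [|q1] := eqVneq (dot v v / 2) 1; [by left|right].
have q2' : 2 <= dot v v / 2.
  have := intr_ge _ 1 qint; rewrite (_ : 1%:~R = 1) // (_ : (1 + 1)%:~R = 2) //; apply.
  by rewrite lt_def q1 /=; lra.
case: L v vL v0 qint q2 q1 q2' => v vL v0 qint q2 q1 q2' /=.
- move: vL => [vi vs].
  have /intrP[a ha] := vi ord0.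
  have v1 : v 0 (lift ord0 ord0) = - a%:~R.
    by move: vs; rewrite /csum !big_ord_recl big_ord0 ha; lra.
  have qE : dot v v / 2 = (a * a)%:~R.
    by rewrite /dot !big_ord_recl big_ord0 v1 ha intrM; field.
  rewrite expr1; move: q2'; rewrite qE (_ : 2 ^+ 2 = 4%:~R); last by rewrite -natrX.
  rewrite (_ : 2 = 2%:~R :> R) // !ler_int => h.
  have [a1|[a1|a1]] : a <= -2 \/ (-1 <= a /\ a <= 1) \/ 2 <= a by lia.
  - by nia.
  - by case: a1 => ? ?; nia.
  - by nia.
- move: vL => [vi vs].
  have /intrP[a ha] := vi ord0; have /intrP[b hb] := vi (lift ord0 ord0).
  have v1 : v 0 (lift ord0 (lift ord0 ord0)) = - a%:~R - b%:~R.
    by move: vs; rewrite /csum !big_ord_recl big_ord0 ha hb; lra.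
  have qE : dot v v / 2 = (a * a + a * b + b * b)%:~R.
    by rewrite /dot !big_ord_recl big_ord0 v1 ha hb !intrD !intrM; field.
  rewrite ler_sqr ?nnegrE; [|by []|lra].
  move: q2'; rewrite qE (_ : 3 = 3%:~R :> R) // (_ : 2 = 2%:~R :> R) // !ler_int.
  move=> h; have [//|h2] := leP 3 (a * a + a * b + b * b).
  have e : a * a + a * b + b * b = 2 by lia.
  have b1 : -1 <= b <= 1 by apply/andP; split; nia.
  have a1 : -1 <= a <= 1 by apply/andP; split; nia.
  have ea : a = -1 \/ a = 0 \/ a = 1 by lia.
  have eb : b = -1 \/ b = 0 \/ b = 1 by lia.
  by case: ea => [ea|[ea|ea]]; case: eb => [eb|[eb|eb]]; move: e; rewrite ea eb.
- rewrite (_ : 4 ^+ 2 = 2 ^+ 4 :> R); last by rewrite -!natrX.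
  by apply: lerXn2r; rewrite ?nnegrE //; lra.
- rewrite (_ : 16 ^+ 2 = 2 ^+ 8 :> R); last by rewrite -!natrX.
  by apply: lerXn2r; rewrite ?nnegrE //; lra.
Qed.

Lemma is_nL_nval (L : lat) n : @is_nL R L n -> n = nval L.
Proof.
move=> [[z [[v vL <-] z0] nE] [n1 nmin]].
have v0 : v != 0 by apply: contraNneq z0 => ->; rewrite scaler0.
apply/eqP; rewrite eqn_leq -!(ler_nat R); apply/andP; split.
  apply: nmin; last by case: (L); rewrite pnatr_eq1.
  (* Doubled vectors of the second smallest norm: (2,-2), (1,1,-2) and 2 e0. *)
  pose a : seq int := match L with A1 => [:: 4; -4] | A2 => [:: 2; 2; -4] | D4 | E8 => [:: 4] end.
  pose w : @vec R L := halfrow (amb L) a.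
  have wL : lattice L w by apply/lattice_halfrow; rewrite /a; case: (L).
  have h0 : halfrow (amb L) [::] = 0 :> 'rV[R]_(amb L).
    by apply/rowP => j; rewrite !mxE nth_nil mul0r.
  have w2 : (dot w w / 2) ^+ dimL L = (nval L)%:R ^+ 2.
    rewrite -[w]subr0 -h0 dot_halfrow.
    rewrite (_ : zdist2 _ _ _ = match L with A1 => 32 | A2 => 24 | D4 | E8 => 16 end).
      by case: (L) => /=; field.
    by rewrite /a; case: (L).
  have w0 : w != 0.
    apply/eqP => w0; move: w2; rewrite w0 dot0 mul0r expr0n.
    by case: (L) => /= /eqP; rewrite eq_sym sqrf_eq0 pnatr_eq0.
  exists ((ell L)^-1 *: w).
    split; first by exists w.
    by rewrite scaler_eq0 invr_eq0 ellE sqrtr_eq0 lern0 negb_or w0.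
  apply/eqP; rewrite -(eqrXn2 (n:=2)) ?ler0n ?exprn_ge0 ?norm2_ge0 //.
  by rewrite NL_sqr w2.
rewrite -nE -ler_sqr ?nnegrE ?ler0n ?exprn_ge0 ?norm2_ge0 // NL_sqr.
have [q1|//] := norm_gap L v vL v0.
case/negP: n1; rewrite -nE -(eqrXn2 (n:=2)) ?ler01 ?exprn_ge0 ?norm2_ge0 //.
by rewrite NL_sqr q1 !expr1n.
Qed.

End Size.

(** * Existence of the lattice code for A1, A2 and D4 *)

Section Existence.
Context {R : realType}.

Lemma norm2_scale k (u v : 'rV[R]_k) (s : R) : 0 <= s ->
  dot u u = s ^+ 2 * dot v v -> norm2 R u = s * norm2 R v.
Proof. by move=> s0 h; rewrite !norm2E h sqrtrM ?sqr_ge0 // sqrtr_sqr ger0_norm. Qed.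

(** The code consists of all hole classes: a point of TL outside L is at distance rho from L, hence
    a hole, and representatives at squared distance below 2 cannot be congruent. *)
Lemma hole_lattice_code (L : lat) (T : 'M[R]_(amb L)) (s : R) : L <> E8 -> 0 < s ->
  (forall v : @vec R L, amb_space L v ->
     amb_space L (v *m T) /\ dot (v *m T) (v *m T) = s ^+ 2 * dot v v) ->
  (lattice L `<=` image_lattice L T)%classic -> 2 * s ^+ 2 = rho2 L ->
  (forall i : 'I_(nval L), image_lattice L T (hole L i)) ->
  (forall i j : 'I_(nval L), i != j ->
     0 < dot (hole L i - hole L j : @vec R L) (hole L i - hole L j) < 2) ->
  exists c : 'I_(nval L) -> @vec R L, is_lattice_code L (nval L) c.
Proof.
move=> LE s0 hT LT s2 hi hd; exists (fun i => hole L i); exists T.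
have hT' (v : @vec R L) : amb_space L v ->
    amb_space L (v *m T) /\ norm2 R (v *m T) = s * norm2 R v.
  by move=> /hT[h1 h2]; split=> //; apply: norm2_scale => //; apply: ltW.
split=> // [|i j ij hl|x hx]; first by exists s.
  have /andP[d0 d2] := hd i j ij.
  have e : hole L i - hole L j != 0 :> @vec R L by apply/eqP => e; move: d0; rewrite e dot0 ltxx.
  by have := lattice_min _ _ hl e; rewrite leNgt d2.
have [hl|nl] := pselect (lattice L x).
  have n0 : (0 < nval L)%N by case: (L).
  by exists (Ordinal n0); rewrite hole0 /teq subr0.
apply: far_hole => //; first exact: (image_amb hT' x hx).
by rewrite -s2; apply: (image_far hT' LT).
Qed.

Lemma lattice_code_A1 : exists c : 'I_(nval A1) -> @vec R A1, is_lattice_code A1 (nval A1) c.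
Proof.
apply: (hole_lattice_code A1 ((1/2)%:M) (1/2)) => //; first by lra.
- by move=> v av; rewrite mul_mx_scalar !dotE; split; [rewrite /= csumZ av mulr0|ring].
- move=> v hv; exists (2 *: v); first by apply: latticeZ => //; apply: rpred_nat.
  by rewrite mul_mx_scalar scalerA mul1r mulVf ?scale1r // pnatr_eq0.
- by rewrite /=; field.
- move=> i; exists (halfrow 2 (nth [::] [:: [::]; [:: 2; -2]] i)).
    by apply/lattice_halfrow; case: i => [[|[|]]].
  rewrite mul_mx_scalar; apply/rowP; case: i => [[|[|]]] //= ?; case; case=> [|[|]] //= ?;
    rewrite !mxE /=; by field.
- case; case=> [|[|]] //= ?; case; case=> [|[|]] //= ? _;
    rewrite /dot !big_ord_recl big_ord0 !mxE /=; by lra.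
Qed.

Lemma lattice_code_A2 : exists c : 'I_(nval A2) -> @vec R A2, is_lattice_code A2 (nval A2) c.
Proof.
(* The cross product with (1,1,1)/3: on the plane of A2, a quarter turn scaled by 1/sqrt 3. *)
pose T : 'M[R]_3 := \matrix_(i, j)
  ((nth [::] [:: [:: 0; -1; 1]; [:: 1; 0; -1]; [:: -1; 1; 0]] i)`_j / 3).
have TE (v : 'rV[R]_3) (a b c : R) : v 0 ord0 = a -> v 0 (lift ord0 ord0) = b ->
    v 0 (lift ord0 (lift ord0 ord0)) = c ->
    v *m T = mkrow 3 [:: (b - c) / 3; (c - a) / 3; (a - b) / 3].
  move=> <- <- <-; apply/rowP; case; case=> [|[|[|]]] //= ?; rewrite !mxE !big_ord_recl big_ord0 !mxE /=;
    by field.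
have s3 : Num.sqrt (1/3 : R) ^+ 2 = 1/3 by rewrite sqr_sqrtr //; lra.
apply: (hole_lattice_code A2 T (Num.sqrt (1/3))) => //.
- by rewrite sqrtr_gt0; lra.
- move=> v; rewrite /= (TE _ _ _ _ erefl erefl erefl) s3 /csum /dot !big_ord_recl !big_ord0 !mxE /=.
  move=> av; split; first by field.
  have -> : v 0 (lift ord0 (lift ord0 ord0)) = - v 0 ord0 - v 0 (lift ord0 ord0) by lra.
  by field.
- move=> v [vi vs].
  move: vs; rewrite /csum !big_ord_recl big_ord0.
  have := vi ord0; have := vi (lift ord0 ord0); have := vi (lift ord0 (lift ord0 ord0)).
  move ea : (v 0 ord0) => a; move eb : (v 0 (lift ord0 ord0)) => b.
  move ec : (v 0 (lift ord0 (lift ord0 ord0))) => c hc hb ha vs.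
  (* The square of [T] on the plane is multiplication by -1/3, so the preimage of [v] is -3 times
     its image. *)
  exists (mkrow 3 [:: c - b; a - c; b - a]).
    split; last by rewrite /csum !big_ord_recl big_ord0 !mxE /=; ring.
    by case; case=> [|[|[|]]] //= ?; rewrite mxE /= rpredB.
  rewrite (TE _ (c - b) (a - c) (b - a)) ?mxE //.
  have cE : c = - a - b by lra.
  apply/rowP; case; case=> [|[|[|]]] //= hi; rewrite mxE /=.
  + by rewrite (_ : Ordinal hi = ord0) ?ea ?cE; [field|exact: val_inj].
  + by rewrite (_ : Ordinal hi = lift ord0 ord0) ?eb ?cE; [field|exact: val_inj].
  + by rewrite (_ : Ordinal hi = lift ord0 (lift ord0 ord0)) ?ec ?cE; [field|exact: val_inj].
- by rewrite s3 /=; field.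
- move=> i; exists (halfrow 3 (nth [::] [:: [::]; [:: -2; 2; 0]; [:: 0; 2; -2]] i)).
    by apply/lattice_halfrow; case: i => [[|[|[|]]]].
  rewrite (TE _ _ _ _ erefl erefl erefl).
  apply/rowP; case: i => [[|[|[|]]]] //= ?; case; case=> [|[|[|]]] //= ?;
    rewrite !mxE /=; by field.
- case; case=> [|[|[|]]] //= ?; case; case=> [|[|[|]]] //= ? _;
    rewrite /dot !big_ord_recl big_ord0 !mxE /=; by lra.
Qed.

(* The map (a, b) |-> ((a + b)/2, (a - b)/2) on each pair of consecutive coordinates. *)
Definition pairmx k : 'M[R]_k := \matrix_(i, j)
  (if i./2 == j./2 then (if odd i && odd j then - 2^-1 else 2^-1) else 0).

Lemma row_nat k (v : 'rV[R]_k.+1) : exists f : nat -> R, v = \row_i f i.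
Proof. by exists (fun i => v 0 (inord i)); apply/rowP => i; rewrite mxE inord_val. Qed.

Lemma pairmx4 (f : nat -> R) : (\row_(i < 4) f i) *m pairmx 4 =
  mkrow 4 [:: (f 0 + f 1) / 2; (f 0 - f 1) / 2; (f 2 + f 3) / 2; (f 2 - f 3) / 2]%N.
Proof.
apply/rowP; case; case=> [|[|[|[|]]]] //= ?;
  rewrite !mxE !big_ord_recl big_ord0 !mxE /=; by field.
Qed.

Lemma pairmx8 (f : nat -> R) : (\row_(i < 8) f i) *m pairmx 8 =
  mkrow 8 [:: (f 0 + f 1) / 2; (f 0 - f 1) / 2; (f 2 + f 3) / 2; (f 2 - f 3) / 2;
              (f 4 + f 5) / 2; (f 4 - f 5) / 2; (f 6 + f 7) / 2; (f 6 - f 7) / 2]%N.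
Proof.
apply/rowP; case; case=> [|[|[|[|[|[|[|[|]]]]]]]] //= ?;
  rewrite !mxE !big_ord_recl big_ord0 !mxE /=; by field.
Qed.

Lemma sqr_sqrt_half : Num.sqrt (1/2 : R) ^+ 2 = 1/2.
Proof. by rewrite sqr_sqrtr //; lra. Qed.

Lemma lattice_code_D4 : exists c : 'I_(nval D4) -> @vec R D4, is_lattice_code D4 (nval D4) c.
Proof.
apply: (hole_lattice_code D4 (pairmx 4) (Num.sqrt (1/2))) => //.
- by rewrite sqrtr_gt0; lra.
- move=> v _; split=> //; rewrite sqr_sqrt_half; have [f ->] := row_nat 3 v; rewrite pairmx4.
  by rewrite /dot !big_ord_recl !big_ord0 !mxE /=; field.
- move=> v; have [f ->] := row_nat 3 v => -[vi vs].
  have fi (i : 'I_4) : f i \is a Num.int by have := vi i; rewrite mxE.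
  have := fi (inord 0); have := fi (inord 1); have := fi (inord 2); have := fi (inord 3).
  rewrite !inordK // => f3 f2 f1 f0.
  exists (mkrow 4 [:: f 0%N + f 1%N; f 0%N - f 1%N; f 2%N + f 3%N; f 2%N - f 3%N]).
    split; first by case; case=> [|[|[|[|]]]] //= ?; rewrite mxE /=; (apply: rpredD + apply: rpredB).
    rewrite (_ : _ / 2 = f 0%N + f 2%N); first exact: rpredD.
    by rewrite /csum !big_ord_recl big_ord0 !mxE /=; field.
  rewrite [LHS](pairmx4 (nth 0 _)); apply/rowP; case; case=> [|[|[|[|]]]] //= ?; rewrite !mxE /=; by field.
- by rewrite sqr_sqrt_half /=; field.
- move=> i; exists (halfrow 4 (nth [::] [:: [::]; [:: 2; 2; 0; 0]; [:: 2; 0; 2; 0]; [:: 2; 0; 0; 2]] i)).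
    by apply/lattice_halfrow; case: i => [[|[|[|[|]]]]].
  rewrite [LHS](pairmx4 (fun j => (nth 0 _ j)%:~R / 2)).
  apply/rowP; case: i => [[|[|[|[|]]]]] //= ?; case; case=> [|[|[|[|]]]] //= ?;
    rewrite !mxE /=; by field.
- case; case=> [|[|[|[|]]]] //= ?; case; case=> [|[|[|[|]]]] //= ? _;
    rewrite /dot !big_ord_recl big_ord0 !mxE /=; by lra.
Qed.

End Existence.

(** * Existence of the lattice code for E8 *)

Section ExistenceE8.
Context {R : realType}.

(* Doubles of the vectors of E8 whose images under [pairmx 8] represent the code:
   the subset sums of (1/2,..,1/2), e1+e3, e1+e5 and e0+e1 selected by the bits of [i]. *)
Definition E8_code_pre (i : nat) : seq int :=
  let b k : int := odd (i %/ 2 ^ k) in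
  [:: b 0%N + 2 * b 3; b 0%N + 2 * b 1%N + 2 * b 2 + 2 * b 3;
      b 0%N; b 0%N + 2 * b 1%N; b 0%N; b 0%N + 2 * b 2; b 0%N; b 0%N].

Definition E8_code (i : nat) : seq int :=
  let b k : int := odd (i %/ 2 ^ k) in
  [:: b 0%N + b 1%N + b 2 + 2 * b 3; - b 1%N - b 2; b 0%N + b 1%N; - b 1%N;
      b 0%N + b 2; - b 2; b 0%N; 0].

Lemma E8_codeE i : halfrow 8 (E8_code_pre i) *m pairmx 8 = halfrow 8 (E8_code i) :> 'rV[R]_8.
Proof.
rewrite [LHS](pairmx8 (fun j => (nth 0 _ j)%:~R / 2)).
apply/rowP; case; case=> [|[|[|[|[|[|[|[|]]]]]]]] //= ?; rewrite !mxE /=;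
  rewrite ?(intrD, intrM, intrB, intrN); by field.
Qed.

(** [pairmx 8] squares to 1/2, so the listed vector, twice the image of [f], is the preimage of [f];
    its membership in E8 gives L inside TL. *)
Lemma pairmx8_image (f : nat -> R) : lattice E8 (\row_(i < 8) f i) ->
  lattice E8 (mkrow 8 [:: f 0%N + f 1%N; f 0%N - f 1%N; f 2%N + f 3%N; f 2%N - f 3%N;
    f 4%N + f 5%N; f 4%N - f 5%N; f 6%N + f 7%N; f 6%N - f 7%N]).
Proof.
move=> [vi _].
have [e [e2 fe]] : exists e : R, 2 * e \is a Num.int /\
    forall i, (i < 8)%N -> f i - e \is a Num.int.
  case: vi => vi; [exists 0|exists 2^-1]; rewrite ?mulr0 ?mulfV ?pnatr_eq0 ?rpred0 ?rpred1;
    split=> // i hi; have := vi (Ordinal hi); rewrite mxE ?subr0 //.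
have hD i j : (i < 8)%N -> (j < 8)%N -> f i + f j \is a Num.int.
  move=> hi hj; rewrite (_ : _ + _ = (f i - e) + (f j - e) + 2 * e); last by ring.
  by apply: rpredD => //; apply: rpredD; apply: fe.
have hB i j : (i < 8)%N -> (j < 8)%N -> f i - f j \is a Num.int.
  move=> hi hj; rewrite (_ : _ - _ = (f i - e) - (f j - e)); last by ring.
  by apply: rpredB; apply: fe.
split.
  by left; case; case=> [|[|[|[|[|[|[|[|]]]]]]]] //= ?; rewrite mxE /= ?hD ?hB.
rewrite (_ : _ / 2 = (f 0%N + f 2%N) + (f 4%N + f 6%N)); last first.
  by rewrite /csum !big_ord_recl big_ord0 !mxE /=; field.
by apply: rpredD; apply: hD.
Qed.

Lemma odd_abszD (x y : int) : odd `|x + y| = odd `|x| (+) odd `|y|.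
Proof. lia. Qed.

Lemma dvd4_double (x : int) : (4 %| `|(2 * x)%R|)%N = ~~ odd `|x|.
Proof. lia. Qed.

(** [b1] and [b2] give the second and third pair sums of [w] the parity of the fourth; the first
    follows since the total is even. [b3] makes [w 0 + w 2 + w 4 + w 6] even, so the entries add up
    to a multiple of 4. *)
Lemma zlattice_pairs (a : nat -> int)
  (b1 := odd `|a 2 + a 3 + a 6 + a 7|) (b2 := odd `|a 4 + a 5 + a 6 + a 7|)
  (b3 := odd `|a 0%N + a 2 + a 4 + a 6|)
  (w := fun j => a j - nth 0 [:: b3%:Z; b1%:Z + b2 + b3; 0; b1%:Z; 0; b2%:Z; 0; 0] j) :
  ~~ odd `|a 0%N + a 1%N + a 2 + a 3 + a 4 + a 5 + a 6 + a 7| ->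
  zlattice E8 [:: w 0%N + w 1%N; w 0%N - w 1%N; w 2 + w 3; w 2 - w 3;
     w 4 + w 5; w 4 - w 5; w 6 + w 7; w 6 - w 7].
Proof.
move=> aev; rewrite /zlattice.
have -> : zsum (amb E8) [:: w 0%N + w 1%N; w 0%N - w 1%N; w 2 + w 3; w 2 - w 3;
     w 4 + w 5; w 4 - w 5; w 6 + w 7; w 6 - w 7] = 2 * (w 0%N + w 2 + w 4 + w 6).
  by rewrite /zsum /=; ring.
rewrite dvd4_double /= /w /=; move: aev.
rewrite /b1 /b2 /b3 !(odd_abszD, abszN) !absz_nat !oddb.
move: (odd `|a 0%N|) (odd `|a 1%N|) (odd `|a 2|) (odd `|a 3|) => [] [] [] [];
move: (odd `|a 4|) (odd `|a 5|) (odd `|a 6|) (odd `|a 7|) => [] [] [] [] //.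
Qed.

Lemma lattice_code_E8 : exists c : 'I_(nval E8) -> @vec R E8, is_lattice_code E8 (nval E8) c.
Proof.
exists (fun i => halfrow 8 (E8_code i)); exists (pairmx 8); split.
- exists (Num.sqrt (1/2)); first by rewrite sqrtr_gt0; lra.
  move=> v _; split=> //; apply: norm2_scale; first exact: sqrtr_ge0.
  rewrite sqr_sqrt_half; have [f ->] := row_nat 7 v; rewrite pairmx8.
  by rewrite /dot !big_ord_recl !big_ord0 !mxE /=; field.
- move=> v; have [f ->] := row_nat 7 v => /pairmx8_image hf; eexists; first exact: hf.
  rewrite [LHS](pairmx8 (nth 0 _)); apply/rowP.
  case; case=> [|[|[|[|[|[|[|[|]]]]]]]] //= ?; rewrite !mxE /=; by field.
- move=> i; exists (halfrow 8 (E8_code_pre i)); last exact: E8_codeE.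
  apply/lattice_halfrow.
  have : all (fun i => zlattice E8 (E8_code_pre i)) (iota 0 16) by vm_compute.
  by move/allP; apply; rewrite mem_iota /= ltn_ord.
- move=> i j ij; rewrite /teq.
  pose d := mkseq (fun l => nth 0 (E8_code i) l - nth 0 (E8_code j) l) 8.
  rewrite (_ : _ - _ = halfrow 8 d); last first.
    by apply/rowP => l; rewrite !mxE nth_mkseq // intrB mulrBl.
  move/lattice_halfrow.
  have : all (fun i => all (fun j => (i == j) || ~~ zlattice E8
      (mkseq (fun l => nth 0 (E8_code i) l - nth 0 (E8_code j) l) 8)) (iota 0 16)) (iota 0 16).
    by vm_compute.
  move/allP/(_ i); rewrite mem_iota ltn_ord => /(_ isT) /allP /(_ j).
  rewrite mem_iota ltn_ord => /(_ isT); rewrite (negPf (ij : (i != j :> nat))) /=.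
  by rewrite -/d => /negP h /h.
- move=> _ [y + <-]; have [f ->] := row_nat 7 y => -[yi ys].
  (* The bit [b0] tells whether [y] is half-integral; the other three bits are parities of the
     integers left after subtracting [b0 / 2]. *)
  have [b0 /choice[z hz]] : exists b0 : bool, forall j : 'I_8, exists z : int,
      f j = z%:~R + b0%:R / 2.
    case: yi => yi; [exists false|exists true] => j; have /intrP[z e] := yi j; exists z.
      by move: e; rewrite mxE => ->; rewrite mul0r addr0.
    by move: e; rewrite mxE => /(canRL (subrK _)) ->; rewrite mul1r.
  pose a j := z (inord j).
  have ha j : (j < 8)%N -> f j = (a j)%:~R + b0%:R / 2.
    by move=> hj; rewrite -hz inordK.
  have aev : ~~ odd `|a 0%N + a 1%N + a 2 + a 3 + a 4 + a 5 + a 6 + a 7|.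
    have cs : csum R (\row_(j < 8) f j) / 2 =
        (a 0%N + a 1%N + a 2 + a 3 + a 4 + a 5 + a 6 + a 7)%:~R / 2 + 2%:R * b0%:R.
      rewrite /csum !big_ord_recl big_ord0 !mxE /= /bump /= !ha //.
      by rewrite !intrD; field.
    rewrite -(half_int (R := R)) -(addrK (2%:R * b0%:R) (_ / 2)) -cs; apply: rpredB => //.
    by apply: rpredM; apply: rpred_nat.
  pose b3 := odd `|a 0%N + a 2 + a 4 + a 6|.
  pose b1 := odd `|a 2 + a 3 + a 6 + a 7|.
  pose b2 := odd `|a 4 + a 5 + a 6 + a 7|.
  pose i := (b0 + 2 * b1 + 4 * b2 + 8 * b3)%N.
  have [i16 ib0 ib1 ib2 ib3] : [/\ (i < 16)%N, odd (i %/ 2 ^ 0) = b0, odd (i %/ 2 ^ 1) = b1,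
      odd (i %/ 2 ^ 2) = b2 & odd (i %/ 2 ^ 3) = b3].
    by rewrite /i; case: b0 {hz ha aev i}; case: b1; case: b2; case: b3.
  exists (Ordinal i16); rewrite /teq -E8_codeE -mulmxBl.
  pose w (j : nat) : int := a j - nth 0 [:: b3%:Z; b1%:Z + b2 + b3; 0; b1%:Z; 0; b2%:Z; 0; 0] j.
  have -> : \row_(j < 8) f j - halfrow 8 (E8_code_pre (Ordinal i16)) = \row_(j < 8) (w j)%:~R.
    rewrite /E8_code_pre ib0 ib1 ib2 ib3.
    apply/rowP; case; case=> [|[|[|[|[|[|[|[|]]]]]]]] //= ?; rewrite !mxE /= ha // /w /=;
      rewrite ?(intrD, intrM, intrB, intrN) -?pmulrn; by field.
  rewrite (pairmx8 (fun j => (w j)%:~R)).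
  rewrite (_ : mkrow 8 _ = halfrow 8 [:: w 0%N + w 1%N; w 0%N - w 1%N; w 2 + w 3; w 2 - w 3;
     w 4 + w 5; w 4 - w 5; w 6 + w 7; w 6 - w 7]); last first.
    apply/rowP; case; case=> [|[|[|[|[|[|[|[|]]]]]]]] //= ?; rewrite !mxE /=;
      by rewrite ?(intrD, mulrNz).
  exact/lattice_halfrow/zlattice_pairs.
Qed.

End ExistenceE8.

(** * Assembly *)

Lemma lattice_code_spread (R : realType) (L : lat) (c : 'I_(nval L) -> @vec R L) :
  is_lattice_code L (nval L) c -> (forall i, amb_space L (c i)) /\ spread L _ c.
Proof.
move=> [T [[s s0 hT] LT cT cd cs]].
have sg := scale_ge s0 hT c cs; split=> [i|i j ij l hl]; first exact: (image_amb hT).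
by apply: (le_trans sg); apply: (image_far hT LT) => //; [apply: imageB|apply: cd].
Qed.

Lemma lattice_code_embed (R : realType) (L : lat) k (c : 'I_(nval L) -> @vec R L)
  (c' : 'I_k -> @vec R L) (i1 : 'I_k) :
  is_lattice_code L (nval L) c -> (forall i, amb_space L (c' i)) -> spread L _ c' ->
  exists g : @vec R L -> @vec R L, torus_isometry L g /\
    (forall i, exists j, teq L (g (c' i)) (c j)).
Proof.
move=> lc ac' sc'; have [ac sc] := lattice_code_spread R L c lc.
have [T [[s s0 hT] LT cT cd cs]] := lc.
have [i0 c0] : exists i0, lattice L (c i0).
  have [i0] := cs 0 (LT _ (lattice0 L)); rewrite /teq sub0r => h.
  by exists i0; rewrite -[c i0]opprK; apply: latticeN.
have [LE|LE] := pselect (L = E8); last exact: (embed_holes L k c c' i0 i1 LE).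
subst L.
have sg : 1 <= 2 * s ^+ 2 := scale_ge s0 hT c cs.
have [i ii0] : exists i, i != i0.
  have [->|h] := eqVneq i0 ord0; first by exists ord_max.
  by exists ord0; rewrite eq_sym.
have ni : ~ lattice E8 (c i).
  move=> hi; apply: (far_nlattice E8 _ _ (rho2_gt0 E8) (sc _ _ ii0)); exact: latticeB.
have sl : 2 * s ^+ 2 <= 1 := scale_le hT LT _ (cT i) ni.
have s2 : 2 * s ^+ 2 = 1 by apply/eqP; rewrite eq_le sl sg.
have sing i2 j : singular (c' i2 - c' j).
  have [->|ij] := eqVneq i2 j; last by apply: far_singular; apply: sc'.
  by rewrite subrr; apply/lattice_singular/lattice0.
have [||g [gi gM]] := embed_E8 hT LT s2 k (fun i => c' i - c' i1).
- by move=> i2; apply: sing.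
- move=> a b; cbv beta; have [_ h1] := sing a i1; have [_ h2] := sing b i1; have [_ h3] := sing a b.
  pose u := c' a - c' i1; pose v := c' b - c' i1; rewrite -/u -/v in h1 h2 *.
  have e : c' a - c' b = u - v by rewrite /u /v opprB addrA subrK.
  rewrite e in h3; clear e; clearbody u v.
  (* Polarization: singular differences make the polar form vanish on the translated code. *)
  rewrite (_ : 2 * dot u v = dot u u + dot v v - dot (u - v) (u - v)).
    by apply: rpredB => //; apply: rpredD.
  by rewrite !dotE (dotC v u); ring.
exists (g \o (fun x => x + - c' i1)); split.
  by apply: isometry_comp => //; apply: translation_isometry.
by move=> i2; apply: cs; apply: gM.
Qed.

Theorem theorem4p12 (R : realType) (L : lat) (n : nat) :
  @is_nL R L n ->
  (exists c : 'I_n -> @vec R L, is_lattice_code L n c) /\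
  (forall c : 'I_n -> @vec R L, is_lattice_code L n c ->
     [/\ optimal_code L n c,
         (forall c' : 'I_n -> @vec R L, optimal_code L n c' ->
            exists g : @vec R L -> @vec R L, torus_isometry L g /\
              (forall i, exists j, teq L (g (c' i)) (c j)) /\
              (forall j, exists i, teq L (g (c' i)) (c j))) &
         (forall c' : 'I_(n.-1) -> @vec R L, optimal_code L n.-1 c' ->
            exists g : @vec R L -> @vec R L, torus_isometry L g /\
              (forall i, exists j, teq L (g (c' i)) (c j)))]).
Proof.
move=> /is_nL_nval ->; split.
  case: L; [exact: lattice_code_A1|exact: lattice_code_A2|exact: lattice_code_D4
    |exact: lattice_code_E8].
move=> c lc; have [ac sc] := lattice_code_spread R L c lc.
have n1 : (1 < nval L)%N by case: (L).
have n0 : (0 < (nval L).-1)%N by rewrite -ltnS prednK // ltnW.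
split; first exact: spread_optimal.
- move=> c' oc; have [[ac' _] _] := oc.
  have sc' := optimal_spread L _ _ c c' (leqnn _) ac sc oc.
  have [g [gi gc]] := lattice_code_embed R L _ c c' (Ordinal (ltnW n1)) lc ac' sc'.
  exists g; split=> //; split=> //; have /choice[f hf] := gc.
  (* [g] preserves distances, so distinct points of [c'] go to distinct classes; equal sizes then
     give surjectivity onto [c]. *)
  have finj : injective f.
    move=> i j fij; apply/eqP/negPn/negP => ij.
    have := (spread_tdist L _ c').1 sc' i j ij; have [_ [_ [<- // _]]] := gi.
    move/(tdist_ge _ _ _ _ (rho_ge0 L)); rewrite rho_sqr.
    move/(far_nlattice _ _ _ (rho2_gt0 L)); apply.
    by apply: teq_trans (hf i) _; rewrite fij; apply: teq_sym; apply: hf.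
  by move=> j; have /codomP[i ->] := inj_card_onto finj (leqnn _) j; exists i.
- move=> c' oc; have [[ac' _] _] := oc.
  apply: (lattice_code_embed R L _ c c' (Ordinal n0)) => //.
  exact: (optimal_spread L _ _ c c' (leq_pred _)).
Qed.
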